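(* Let $\lambda = \max_{\alpha >0} \frac{1-e^{-\alpha}}{2\sqrt{\alpha}}$. There exists $\xi>0$ such that for every $0< \varepsilon \leq 1/2$ there exists $r_0(\varepsilon)$ such that for all integers $r\ge r_0(\varepsilon)$ and all integers $l$ with $\sqrt{\log r}/\varepsilon \leq l \leq \log r$, $$c_\infty(lK_r) \geq lr + (1-\varepsilon)\frac{\lambda^2r\log r}{4l} -lr\exp\left(-\frac{\xi\varepsilon\log{r}}{l}\right).$$
   Context: All graphs are finite and simple. $K_r$ is the complete graph on $r$ vertices and $lK_r$ the disjoint union of $l$ copies of $K_r$. A graph $H$ is a minor of $G$ if a graph isomorphic to $H$ can be obtained from a subgraph of $G$ by contracting edges. For a non-null graph $G$, $d(G)=e(G)/v(G)$. For a graph $H$, $c_\infty(H)=\lim_{n\to\infty}\max d(G)$, the maximum over all graphs $G$ on $n$ vertices not containing $H$ as a minor. $\log$ is the natural logarithm. ''$r \gg 1/\varepsilon$'' in the paper means $r$ is sufficiently large as a function of $\varepsilon$. *)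

(* Defs.v *)
From HB Require Import structures.
From mathcomp Require Import all_boot all_order all_algebra.

Set Implicit Arguments.
Unset Strict Implicit.
Unset Printing Implicit Defensive.

Record sgraph := SGraph {
  vertex :> finType;
  adj : rel vertex;
  adj_sym : symmetric adj;
  adj_irr : irreflexive adj }.

Arguments adj {s} _ _.

Definition edges (G : sgraph) : {set {set G}} :=
  [set [set p.1; p.2] | p in [set p : G * G | adj p.1 p.2]].

Definition isomorphic (G H : sgraph) : Prop :=
  exists2 f : G -> H, bijective f & forall x y, adj (f x) (f y) = adj x y.

(* Up to isomorphism: neither induced nor spanning. *)
Definition subgraph (H G : sgraph) : Prop :=
  exists2 f : H -> G, injective f & forall x y, adj x y -> adj (f x) (f y).

Section Contract.
Variables (G : sgraph) (x y : G).

(* y is merged into x; loops and parallel edges are suppressed. *)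
Definition contract_adj (a b : {z : G | z != y}) : bool :=
  (a != b) && [|| adj (val a) (val b),
                  (val a == x) && adj y (val b) |
                  (val b == x) && adj y (val a)].

Fact contract_sym : symmetric contract_adj.
Proof.
move=> a b; rewrite /contract_adj eq_sym (@adj_sym G (val a)).
by congr (_ && (_ || _)); rewrite orbC.
Qed.

Fact contract_irr : irreflexive contract_adj.
Proof. by move=> a; rewrite /contract_adj eqxx. Qed.

Definition contract_edge : sgraph := SGraph contract_sym contract_irr.

End Contract.

Inductive contracts_to (G H : sgraph) : Prop :=
| contracts_iso of isomorphic G H
| contracts_step (x y : G) of adj x y & contracts_to (contract_edge x y) H.

Definition minor (H G : sgraph) : Prop :=
  exists2 G' : sgraph, subgraph G' G & contracts_to G' H.

Section Complete.
Variable r : nat.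

Definition complete_adj (i j : 'I_r) : bool := i != j.

Fact complete_sym : symmetric complete_adj.
Proof. by move=> i j; rewrite /complete_adj eq_sym. Qed.

Fact complete_irr : irreflexive complete_adj.
Proof. by move=> i; rewrite /complete_adj eqxx. Qed.

Definition complete_graph : sgraph := SGraph complete_sym complete_irr.

End Complete.

Section Copies.
Variables (l : nat) (H : sgraph).

Definition copies_adj (p q : 'I_l * H) : bool :=
  (p.1 == q.1) && adj p.2 q.2.

Fact copies_sym : symmetric copies_adj.
Proof. by move=> p q; rewrite /copies_adj eq_sym (@adj_sym H). Qed.

Fact copies_irr : irreflexive copies_adj.
Proof. by move=> p; rewrite /copies_adj (@adj_irr H) andbF. Qed.

Definition copies : sgraph := SGraph copies_sym copies_irr.

End Copies.

From mathcomp Require Import all_classical all_reals all_analysis.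

Import Order.TTheory GRing.Theory Num.Theory.
Import numFieldNormedType.Exports.

Local Open Scope classical_set_scope.
Local Open Scope ring_scope.

Definition density (R : realType) (G : sgraph) : R :=
  #|edges G|%:R / #|G|%:R.

(* There are finitely many graphs on n vertices up to isomorphism, so this
   supremum is a maximum whenever some graph on n vertices has no H minor
   (and is 0 otherwise). *)
Definition max_density (R : realType) (H : sgraph) (n : nat) : R :=
  sup [set d | exists G : sgraph,
             [/\ #|G| = n, ~ minor H G & d = density R G]].

(* [limn] takes an unspecified value on divergent sequences: any bound on
   [c_infty] has to go through the convergence of [max_density R H]. *)
Definition c_infty (R : realType) (H : sgraph) : R :=
  limn (max_density R H).

(* The supremum is attained: the function is positive and continuous, and
   tends to 0 both at 0 and at +oo. *)
Definition lambda (R : realType) : R :=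
  sup [set (1 - expR (- a)) / (2 * Num.sqrt a) | a in [set a : R | 0 < a]].

(* Main.v *)
Require Import Defs.
From mathcomp Require Import all_boot all_order all_algebra.
From mathcomp Require Import zify ring lra.

(* Lower bound: join an independent set S of l(r - q) vertices to many disjoint
   copies of one graph H on m vertices, where H is random with edge probability
   1/2 and each pair between S and H is missing with probability 2^-j. If this
   has an lK_r minor, some K_r meets S in at most r - q vertices, so q of its
   branch sets lie in a single copy of H and must be adjacent to the r - q
   others. Splitting the m vertices of H evenly between the two groups is the
   best choice, and a union bound over all choices shows that this does not
   happen for suitable m ~ rL/2l, q ~ rL/18l^2 and j ~ L/100l, where L = log r.
   The density is about l(r - q)(1 - 2^-j) + m/4, which suffices since
   lambda <= 1/2. When l > L/100, take for H a single vertex and q = 2.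

   Convergence of the maximal densities: a graph without K_t minor has balanced
   separators of size n/log^2 n (grow balls until one of them expands slowly;
   if none does, all balls meet and the clique model can be enlarged). Recursive
   separation covers the edges by pieces of bounded size with few repeated
   vertices, and for n <= N the densest pieces of an extremal graph on N
   vertices can be chosen to span n vertices with almost the same density, so
   that the sequence of maximal densities is almost non-increasing. *)

Set Implicit Arguments.
Unset Strict Implicit.
Unset Printing Implicit Defensive.

Import Order.TTheory GRing.Theory Num.Theory.

(** Convergence needs an argument because [lK_r] is disconnected: two disjoint graphs without an
    [lK_r] minor may have one together, so disjoint unions give no superadditivity and Fekete's
    lemma is out of reach. Passing to subgraphs is always allowed, hence the comparison of large
    orders with smaller ones. Separators of size n/log^2 n serve because the logarithm of the size
    drops by a constant per round: the repetitions then add up like a sum of 1/k^2, whose tail is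
    small. In the lower bound, links between S and H must be missing with some probability, for
    otherwise a branch set in H is adjacent to every one that meets S. Their loss is the exponential
    term of the theorem. All copies of H share one pattern of links, so the union bound ranges over
    exp(O(rL^2)) structures, whatever the number of copies. A structure asks for q(r - q)
    adjacencies, each failing with probability at least about r^(-9/10) on average, so all hold with
    probability at most exp(-r^(11/10)/36L), which wins by a power of r. *)

(** * Minors as branch sets *)

(* Connectedness through cuts rather than paths. *)
Definition conn_set (G : sgraph) (A : {set G}) : Prop :=
  forall X : {set G}, X \subset A -> X != set0 -> X != A ->
  exists x y, [/\ x \in X, y \in A :\: X & adj x y].

(** One partial map has all branch sets as its fibres, so disjointness is built in and counting
    models amounts to counting functions. [None] marks the vertices outside the model. *)
Definition is_model (H G : sgraph) (F : G -> option H) : Prop :=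
  [/\ forall h, exists x, F x = Some h,
      forall h, conn_set [set x | F x == Some h] &
      forall h k, adj h k -> exists x y, [/\ F x = Some h, F y = Some k & adj x y]].

Lemma conn_set1 (G : sgraph) (x : G) : conn_set [set x].
Proof.
move=> X; rewrite subset1 => /orP[/eqP->|/eqP->]; first by rewrite eqxx.
by rewrite eqxx.
Qed.

Definition contract_map (G : sgraph) (x y : G) (xy : x != y) (z : G) :
    contract_edge x y :=
  insubd (Sub x xy : {z : G | z != y}) z.

Lemma val_contract_map (G : sgraph) (x y : G) (xy : x != y) (z : G) :
  val (contract_map xy z) = if z == y then x else z.
Proof. by rewrite val_insubd; case: eqP. Qed.

Lemma contract_map_val (G : sgraph) (x y : G) (xy : x != y) a :
  contract_map xy (val a) = a.
Proof. by apply: val_inj; rewrite val_contract_map (negPf (valP a)). Qed.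

Lemma contract_map_glue (G : sgraph) (x y : G) (xy : x != y) :
  contract_map xy y = contract_map xy x.
Proof. by apply: val_inj; rewrite !val_contract_map eqxx (negPf xy). Qed.

Lemma contract_map_eq (G : sgraph) (x y : G) (xy : x != y) z w :
  contract_map xy z = contract_map xy w ->
  [\/ z = w, z = x /\ w = y | z = y /\ w = x].
Proof.
move/(congr1 val); rewrite !val_contract_map.
case: eqP => [->|_]; case: eqP => [->|_] e; subst.
- by constructor 1.
- by constructor 3.
- by constructor 2.
- by constructor 1.
Qed.

Lemma adj_contract_map (G : sgraph) (x y : G) (xy : x != y) (z w : G) :
  adj z w -> contract_map xy z != contract_map xy w ->
  adj (contract_map xy z) (contract_map xy w).
Proof.
move=> zw ne; rewrite /= /contract_adj ne /= !val_contract_map.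
case: (eqVneq z y) zw ne => [->|zy]; case: (eqVneq w y) => [->|wy] zw ne.
- by rewrite eqxx in ne.
- by rewrite eqxx zw orbT.
- by rewrite eqxx (@adj_sym G y z) zw !orbT.
- by rewrite zw.
Qed.

Lemma contract_map_lift (G : sgraph) (x y : G) (xy : x != y)
    (a b : contract_edge x y) :
  adj a b -> exists z w,
    [/\ adj z w, contract_map xy z = a & contract_map xy w = b].
Proof.
case/andP=> _ /or3P[ab|/andP[/eqP ax yb]|/andP[/eqP bx ya]].
- by exists (val a), (val b); rewrite !contract_map_val.
- exists y, (val b); rewrite contract_map_glue contract_map_val; split=> //.
  by apply: val_inj; rewrite val_contract_map (negPf xy) ax.
- exists (val a), y; rewrite contract_map_glue contract_map_val adj_sym.
  by split=> //; apply: val_inj; rewrite val_contract_map (negPf xy) bx.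
Qed.

Lemma model_of_contract (H G : sgraph) (x y : G) (xy : x != y)
    (F : contract_edge x y -> option H) :
  adj x y -> is_model F -> is_model (F \o contract_map xy).
Proof.
move=> axy [Fs Fc Fa]; split.
- by move=> h; have [a Fah] := Fs h; exists (val a); rewrite /= contract_map_val.
- move=> h X Xsub X0 Xn; set p := contract_map xy in Xsub Xn *.
  have inF z : z \in X -> F (p z) = Some h.
    by move/(subsetP Xsub); rewrite inE => /eqP.
  (* If [X] separates [x] from [y], the contracted edge leaves [X]. Otherwise [X] is a union of
     fibres of [p] ([sat]), and an edge leaving its image lifts. *)
  have [/andP[xX yX]|nx] := boolP ((x \in X) && (y \notin X)).
    exists x, y; split => //; rewrite !inE yX /= /p contract_map_glue.
    by apply/eqP/inF.
  have [/andP[xX yX]|ny] := boolP ((y \in X) && (x \notin X)).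
    exists y, x; split; rewrite 1?adj_sym // !inE yX /= /p -contract_map_glue.
    by apply/eqP/inF.
  have sat z : p z \in p @: X -> z \in X.
    case/imsetP=> w wX /contract_map_eq[->//|[? ?]|[? ?]]; subst.
      by rewrite wX /= negbK in ny.
    by rewrite wX /= negbK in nx.
  have [] := Fc h (p @: X).
  - by apply/subsetP=> a /imsetP[z zX ->]; rewrite inE inF.
  - by rewrite imset_eq0.
  - apply: contra Xn => /eqP eX; rewrite eqEsubset Xsub; apply/subsetP=> z.
    by rewrite inE => Fz; apply: sat; rewrite eX inE.
  move=> a [b [/imsetP[z0 z0X ->] bX ab]].
  have [z [w [zw pz pw]]] := contract_map_lift xy ab.
  exists z, w; split => //; first by apply: sat; apply/imsetP; exists z0.
  move: bX; rewrite -pw !inE => /andP[wX ->]; rewrite andbT.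
  by apply: contra wX => wX; apply/imsetP; exists w.
- move=> h k /Fa[a [b [Fah Fbk ab]]].
  have [z [w [zw pz pw]]] := contract_map_lift xy ab.
  by exists z, w; rewrite /= pz pw.
Qed.

Lemma contracts_model (G H : sgraph) :
  contracts_to G H -> exists F : G -> option H, is_model F.
Proof.
elim=> {G H} [G H [f bf fa]|G H x y axy _ [F mF]].
  exists (Some \o f); have [g fK gK] := bf; split.
  - by move=> h; exists (g h); rewrite /= gK.
  - move=> h; have -> : [set x | (Some \o f) x == Some h] = [set g h].
      by apply/setP=> x; rewrite !inE /= -(inj_eq (bij_inj bf)) gK.
    exact: conn_set1.
  - by move=> h k hk; exists (g h), (g k); rewrite /= !gK -fa !gK.
have xy : x != y by apply: contraTneq axy => ->; rewrite adj_irr.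
by exists (F \o contract_map xy); apply: model_of_contract.
Qed.

Lemma model_subgraph (H G' G : sgraph) (F : G' -> option H) :
  is_model F -> subgraph G' G -> exists F' : G -> option H, is_model F'.
Proof.
move=> [Fs Fc Fa] [f fI fa].
pose F' x := if [pick z | f z == x] is Some z then F z else None.
have F'f z : F' (f z) = F z.
  rewrite /F'; case: pickP => [w /eqP/fI ->//|/(_ z)]; by rewrite eqxx.
have fib h : [set x | F' x == Some h] = f @: [set x | F x == Some h].
  apply/setP=> x; rewrite inE; apply/idP/imsetP=> [|[z]].
    rewrite /F'; case: pickP => [z /eqP<- Fz|//]; exists z => //.
    by rewrite inE.
  by rewrite inE => Fz ->; rewrite F'f.
exists F'; split.
- by move=> h; have [z Fz] := Fs h; exists (f z); rewrite F'f.
- move=> h X; rewrite fib => Xs X0 Xn.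
  have XE : X = f @: (f @^-1: X).
    apply/setP=> x; apply/idP/imsetP=> [xX|[z]]; last by rewrite inE => ? ->.
    by have /imsetP[z _ e] := subsetP Xs _ xX; exists z; rewrite // inE -e.
  have [] := Fc h (f @^-1: X).
  - by apply/subsetP=> x; rewrite !inE => /(subsetP Xs); rewrite mem_imset // inE.
  - by move: X0; rewrite XE imset_eq0 -XE.
  - by apply: contra Xn => /eqP <-; rewrite -XE.
  move=> x [y [xX yX xy]]; exists (f x), (f y); split; last exact: fa.
    by rewrite inE in xX.
  move: yX; rewrite !inE => /andP[-> Fy]; apply/imsetP; exists y => //.
  by rewrite inE.
- move=> h k /Fa[x [y [Fx Fy xy]]]; exists (f x), (f y).
  by rewrite !F'f; split => //; apply: fa.
Qed.

Lemma minor_model (H G : sgraph) :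
  minor H G -> exists F : G -> option H, is_model F.
Proof. by case=> G' sG /contracts_model[F mF]; apply: model_subgraph mF sG. Qed.

(** A fibre with two vertices is connected, so it contains an edge to contract, and [f] factors
    through the contraction. Once all fibres are singletons, [f] is an isomorphism. *)
Lemma contracts_of_map (H : sgraph) n (G : sgraph) (f : G -> H) :
  #|G| <= n ->
  (forall h, exists x, f x = h) -> (forall h, conn_set [set x | f x == h]) ->
  (forall x y, adj x y -> f x = f y \/ adj (f x) (f y)) ->
  (forall h k, adj h k -> exists x y, [/\ f x = h, f y = k & adj x y]) ->
  contracts_to G H.
Proof.
elim: n => [|n IH] in G f *.
  rewrite leqn0 => /eqP/card0_eq G0 fs _ _ _; apply: contracts_iso; exists f.
    have f0 : forall h : H, False by move=> h; have [x] := fs h; have := G0 x.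
    by exists (fun h => False_rect _ (f0 h)) => [x|h]; [have := G0 x|case: (f0 h)].
  by move=> x; have := G0 x.
move=> Gn fs fc fa fl.
have [/injectiveP fI|/injectivePn[x [z xz fxz]]] := boolP (injectiveb f).
  apply: contracts_iso; exists f.
    apply: (inj_card_bij fI); rewrite -(card_codom fI).
    by apply: subset_leq_card; apply/subsetP=> h _; have [x <-] := fs h; apply: codom_f.
  move=> x y; apply/idP/idP => [/fl[x' [y' [/fI-> /fI->]]]//|xy].
  by have [/fI e|//] := fa _ _ xy; rewrite e adj_irr in xy.
have [] := fc (f x) [set x].
- by rewrite sub1set inE.
- by apply/set0Pn; exists x; rewrite inE.
- apply: contraNneq xz => e; suff : z \in [set x] by rewrite inE eq_sym.
  by rewrite e inE fxz.
move=> _ [y [/set1P-> ]]; rewrite !inE => /andP[yx /eqP fyx] axy.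
have xy : x != y by rewrite eq_sym.
have fp w : f (val (contract_map xy w)) = f w.
  by rewrite val_contract_map; case: eqP => [->|].
apply: (contracts_step axy); apply: (IH (contract_edge x y) (fun a => f (val a))).
- by rewrite card_sig (cardC1 y) -ltnS prednK //; apply/card_gt0P; exists x.
- by move=> h; have [w <-] := fs h; exists (contract_map xy w).
- move=> h X Xs X0 Xn.
  have [] := fc h [set w | contract_map xy w \in X].
  - by apply/subsetP=> w; rewrite !inE => /(subsetP Xs); rewrite inE fp.
  - have /set0Pn[a aX] := X0; apply/set0Pn; exists (val a).
    by rewrite inE contract_map_val.
  - apply: contra Xn => /eqP e; rewrite eqEsubset Xs; apply/subsetP=> a.
    by rewrite inE => fa'; have /setP/(_ (val a)) := e; rewrite !inE contract_map_val fa'.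
  move=> w1 [w2 [w1X w2X w12]]; exists (contract_map xy w1), (contract_map xy w2).
  move: w1X w2X; rewrite !inE fp => w1X /andP[w2X ->]; rewrite w1X w2X; split => //.
  by apply: adj_contract_map => //; apply: contraNneq w2X => <-.
- move=> a b ab; have [z' [w [zw <- <-]]] := contract_map_lift xy ab.
  by rewrite !fp; apply: fa.
- move=> h k hk; have [x' [y' [fx fy xy']]] := fl _ _ hk.
  exists (contract_map xy x'), (contract_map xy y'); rewrite !fp; split => //.
  apply: adj_contract_map => //; apply: contraTneq hk => e.
  by rewrite -fx -fy -(fp x') e fp adj_irr.
Qed.

Section ModelSubgraph.
Variables (H G : sgraph) (F : G -> option H).

(** [contracts_to] ends in an isomorphism, so edges between branch sets that are not adjacent in [H]
    have to be deleted before contracting. *)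
Definition model_adj (a b : {x : G | F x != None}) : bool :=
  adj (val a) (val b) &&
  ((F (val a) == F (val b)) ||
   match F (val a), F (val b) with Some h, Some k => adj h k | _, _ => false end).

Fact model_sym : symmetric model_adj.
Proof.
move=> a b; rewrite /model_adj adj_sym eq_sym; congr (_ && (_ || _)).
by case: (F (val a)) => [h|]; case: (F (val b)) => [k|] //; rewrite adj_sym.
Qed.

Fact model_irr : irreflexive model_adj.
Proof. by move=> a; rewrite /model_adj adj_irr. Qed.

Definition model_graph : sgraph := SGraph model_sym model_irr.

End ModelSubgraph.

Lemma model_minor (H G : sgraph) (F : G -> option H) : is_model F -> minor H G.
Proof.
move=> [Fs Fc Fa]; exists (model_graph F).
  by exists val; [exact: val_inj|move=> x y /andP[]].
have fP (a : model_graph F) : {h | F (val a) = Some h}.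
  by case: (F (val a)) (valP a) => [h _|//]; exists h.
pose f a := sval (fP a); have fE a : F (val a) = Some (f a) := svalP (fP a).
have lift x h : F x = Some h -> {a : model_graph F | val a = x & f a = h}.
  move=> Fx; have Fx' : F x != None by rewrite Fx.
  by exists (Sub x Fx') => //; apply: Some_inj; rewrite -fE.
apply: (@contracts_of_map _ _ _ f (leqnn _)).
- by move=> h; have [x /lift[a _ <-]] := Fs h; exists a.
- move=> h X Xs X0 Xn; have [] := Fc h (val @: X).
  - apply/subsetP=> _ /imsetP[a /(subsetP Xs) aX ->]; move: aX.
    by rewrite !inE fE => /eqP->.
  - by rewrite imset_eq0.
  - apply: contra Xn => /eqP e; rewrite eqEsubset Xs; apply/subsetP=> a.
    rewrite inE => /eqP fa; suff : val a \in val @: X by rewrite (mem_imset _ _ val_inj).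
    by rewrite e inE fE fa.
  move=> x [y [/imsetP[a aX ->]]]; rewrite !inE => /andP[yX /eqP Fy] xy.
  have [b bE fb] := lift _ _ Fy; subst y.
  exists a, b; split => //.
    by rewrite !inE fb eqxx andbT; apply: contra yX => bX; apply: imset_f.
  have := subsetP Xs _ aX; rewrite inE => /eqP fa.
  by rewrite /= /model_adj xy !fE fa fb eqxx.
- move=> a b /andP[_]; rewrite !fE => /orP[/eqP[]|]; by [left|right].
- move=> h k hk; have [x [y [Fx Fy xy]]] := Fa _ _ hk.
  have [a aE fa] := lift _ _ Fx; have [b bE fb] := lift _ _ Fy.
  by exists a, b; split => //; rewrite /= /model_adj !fE aE bE xy fa fb hk orbT.
Qed.

Lemma minor_sub (H G' G : sgraph) : subgraph G' G -> minor H G' -> minor H G.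
Proof.
by move=> sG /minor_model[F mF]; have [F' /model_minor] := model_subgraph mF sG.
Qed.

(** * Balanced separators *)

Definition touch (G : sgraph) (A B : {set G}) : bool :=
  [exists x in A, exists y in B, adj x y].

Lemma touchP (G : sgraph) (A B : {set G}) :
  reflect (exists x y, [/\ x \in A, y \in B & adj x y]) (touch A B).
Proof.
apply: (iffP exists_inP) => [[x xA /exists_inP[y yB xy]]|[x [y [xA yB xy]]]].
  by exists x, y.
by exists x => //; apply/exists_inP; exists y.
Qed.

Lemma touch_sym (G : sgraph) (A B : {set G}) : touch A B = touch B A.
Proof.
by apply/touchP/touchP => -[x [y [xA yB xy]]]; exists y, x; rewrite adj_sym.
Qed.

Definition clique_seq (G : sgraph) (s : seq {set G}) : Prop :=
  (forall A : {set G}, A \in s -> A != set0 /\ conn_set A) /\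
  pairwise (fun A B : {set G} => [disjoint A & B] && touch A B) s.

(** Every [H] lies in the clique on as many vertices. Excluding [H] thus bounds the length of clique
    sequences, which is all that the separator search uses. *)
Lemma clique_seq_minor (H G : sgraph) (s : seq {set G}) :
  clique_seq s -> #|H| <= size s -> minor H G.
Proof.
move=> [sc sp] Hs; pose B (h : H) := nth set0 s (enum_rank h).
have rk (h : H) : enum_rank h < size s by exact: leq_trans (ltn_ord (enum_rank h)) Hs.
have sB h : B h \in s by apply: mem_nth.
have BB h k : h != k -> [disjoint B h & B k] && touch (B h) (B k).
  have /(pairwiseP set0) P := sp => hk.
  have [lt|lt|/val_inj/enum_rank_inj e] := ltngtP (enum_rank h) (enum_rank k).
  - by apply: P; rewrite ?inE.
  - by rewrite disjoint_sym touch_sym; apply: P; rewrite ?inE.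
  - by rewrite e eqxx in hk.
pose F x := [pick h | x \in B h].
have FB x h : (F x == Some h) = (x \in B h).
  rewrite /F; case: pickP => [k xk|/(_ h) -> //].
  apply/eqP/idP => [[<-] //|xh]; congr Some; apply: contraTeq xh => kh.
  have /andP[dkh _] := BB _ _ kh.
  by rewrite (disjointFr dkh xk).
apply: (@model_minor H G F); split.
- move=> h; have [/set0Pn[x xB] _] := sc _ (sB h).
  by exists x; apply/eqP; rewrite FB.
- move=> h; suff -> : [set x | F x == Some h] = B h by have [] := sc _ (sB h).
  by apply/setP=> x; rewrite inE FB.
- move=> h k hk.
  have hk' : h != k by apply: contraTneq hk => ->; rewrite adj_irr.
  have /andP[_ /touchP[x [y [xh yk xy]]]] := BB _ _ hk'.
  by exists x, y; split=> //; apply/eqP; rewrite FB.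
Qed.

Lemma conn_setU (G : sgraph) (A B : {set G}) z :
  z \in A -> z \in B -> conn_set A -> conn_set B -> conn_set (A :|: B).
Proof.
move=> zA zB cA cB X Xs /set0Pn[w wX] Xn.
have key (P : {set G}) : P \subset A :|: B -> conn_set P ->
    X :&: P != set0 -> X :&: P != P ->
    exists x y, [/\ x \in X, y \in (A :|: B) :\: X & adj x y].
  move=> Ps cP n0 nP; have [|x [y [xX yP xy]]] := cP (X :&: P) _ n0 nP.
    exact: subsetIr.
  exists x, y; split=> //; first by case/setIP: xX.
  move: yP; rewrite 2!inE negb_and => /andP[/orP[yX|/negPf->//] yP].
  by rewrite inE yX (subsetP Ps).
have sA : A \subset A :|: B := subsetUl _ _.
have sB : B \subset A :|: B := subsetUr _ _.
have [zX|zX] := boolP (z \in X).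
  have [y yU yX] : exists2 y, y \in A :|: B & y \notin X.
    apply/subsetPn; apply: contra Xn => sub; by rewrite eqEsubset Xs.
  case/setUP: yU => yP; [apply: (key A)|apply: (key B)] => //.
  - by apply/set0Pn; exists z; rewrite inE zX.
  - by apply: contra yX => /eqP e; move: yP; rewrite -e inE => /andP[].
  - by apply/set0Pn; exists z; rewrite inE zX.
  - by apply: contra yX => /eqP e; move: yP; rewrite -e inE => /andP[].
have /setUP[] := subsetP Xs _ wX => wP; [apply: (key A)|apply: (key B)] => //.
- by apply/set0Pn; exists w; rewrite inE wX.
- by apply: contra zX => /eqP e; move: zA; rewrite -e inE => /andP[].
- by apply/set0Pn; exists w; rewrite inE wX.
- by apply: contra zX => /eqP e; move: zB; rewrite -e inE => /andP[].
Qed.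

Lemma conn_set2 (G : sgraph) (x y : G) : adj x y -> conn_set [set x; y].
Proof.
move=> xy X Xs X0 Xn.
have [xX|xX] := boolP (x \in X).
  have yX : y \notin X.
    apply: contra Xn => yX; rewrite eqEsubset Xs; apply/subsetP=> z.
    by case/set2P=> ->.
  by exists x, y; split=> //; rewrite !inE yX eqxx orbT.
have yX : y \in X.
  have /set0Pn[w wX] := X0.
  by have /set2P[e|<-//] := subsetP Xs _ wX; rewrite -e wX in xX.
by exists y, x; split; rewrite 1?adj_sym // !inE xX eqxx.
Qed.

(** * Balls and their growth *)

Fixpoint ball (G : sgraph) (C Z : {set G}) (i : nat) : {set G} :=
  if i is j.+1 then
    ball C Z j :|: [set y in C | touch (ball C Z j) [set y]]
  else Z.

Lemma sub_ballS (G : sgraph) (C Z : {set G}) i : ball C Z i \subset ball C Z i.+1.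
Proof. exact: subsetUl. Qed.

Lemma sub_ball (G : sgraph) (C Z : {set G}) i j :
  i <= j -> ball C Z i \subset ball C Z j.
Proof.
move/subnK<-; elim: (j - i) => [//|k IH].
exact: subset_trans IH (sub_ballS _ _ _).
Qed.

Lemma ball_sub (G : sgraph) (C Z : {set G}) i : Z \subset C -> ball C Z i \subset C.
Proof.
move=> ZC; elim: i => [//|i IH] /=; rewrite subUset IH.
by apply/subsetP=> y; rewrite inE => /andP[].
Qed.

Lemma ball_path (G : sgraph) (C Z : {set G}) i y :
  Z \subset C -> y \in ball C Z i ->
  exists Q : {set G}, [/\ Q \subset C, conn_set Q, y \in Q, #|Q| <= i.+1 &
                          exists2 z, z \in Z & z \in Q].
Proof.
move=> ZC; elim: i y => [|i IH] y /=.
  move=> yZ; exists [set y]; rewrite sub1set (subsetP ZC) // set11 cards1.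
  by split=> //; [exact: conn_set1|exists y; rewrite ?set11].
case/setUP=> [/IH[Q [QC cQ yQ Qi ZQ]]|].
  by exists Q; split=> //; apply: leq_trans Qi _.
rewrite inE => /andP[yC /touchP[x [_ [xB /set1P-> xy]]]].
have [Q [QC cQ xQ Qi [z zZ zQ]]] := IH _ xB.
exists (Q :|: [set x; y]); split.
- by rewrite subUset QC subUset !sub1set yC (subsetP QC _ xQ).
- by apply: (@conn_setU _ _ _ x) => //; [rewrite set21|exact: conn_set2].
- by rewrite !inE eqxx !orbT.
- suff -> : Q :|: [set x; y] = y |: Q.
    by rewrite cardsU1 -add1n leq_add // leq_b1.
  apply/setP=> w; rewrite !inE; case: (eqVneq w x) => [->|]; rewrite ?xQ ?orbT //.
  by rewrite orbC.
- by exists z; rewrite // inE zQ.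
Qed.

(** If none of the first [k] rounds is slow, each multiplies the ball by more than [1 + 1/l], and
    after [k] rounds it would exceed [C]. *)
Lemma ball_growth (G : sgraph) (C Z : {set G}) l k :
  Z \subset C -> Z != set0 -> l ^ k * #|C| < l.+1 ^ k ->
  #|C| < 2 * #|ball C Z k| \/
  exists i, 2 * #|ball C Z i| <= #|C| /\
            l * #|ball C Z i.+1 :\: ball C Z i| <= #|ball C Z i|.
Proof.
move=> ZC Z0 lk; case: (ltnP #|C| (2 * #|ball C Z k|)) => [|small]; first by left.
right; have small' i : i <= k -> 2 * #|ball C Z i| <= #|C|.
  move=> ik; apply: leq_trans small; rewrite leq_mul2l /=.
  by apply: subset_leq_card; apply: sub_ball.
case: (boolP [exists i : 'I_k, l * #|ball C Z i.+1 :\: ball C Z i| <= #|ball C Z i|]).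
  by case/existsP=> i Hi; exists i; split=> //; apply: small'; apply: ltnW.
move=> /existsPn big; exfalso.
suff : l.+1 ^ k <= l ^ k * #|ball C Z k|.
  have : l ^ k * #|ball C Z k| <= l ^ k * #|C|.
    by rewrite leq_mul2l subset_leq_card ?orbT // ball_sub.
  lia.
have : forall i, i <= k -> l.+1 ^ i <= l ^ i * #|ball C Z i|.
  elim=> [|i IH] ik; first by rewrite !expn0 mul1n card_gt0.
  have := big (Ordinal ik); rewrite -ltnNge /= => gt.
  have e : #|ball C Z i.+1| = #|ball C Z i| + #|ball C Z i.+1 :\: ball C Z i|.
    by rewrite cardsD (setIidPr (sub_ballS C Z i)) subnKC // subset_leq_card ?sub_ballS.
  have := IH (ltnW ik); move: e gt; rewrite /=.
  set b := #|ball C Z i|; set b' := #|_ :|: _|; set d := #|_ :\: _| => -> gt IHi.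
  rewrite !expnS.
  apply: (@leq_trans (l.+1 * (l ^ i * b))); first by rewrite leq_mul2l IHi orbT.
  rewrite mulnCA [l * l ^ i]mulnC -mulnA leq_mul2l; apply/orP; right; nia.
by apply.
Qed.

(* Invariant of the separator search: inside [U], the part [D] has been split
   off, [C] is still active, [S] has been deleted, and the bags [s], pairwise
   adjacent, will be deleted at the end. *)
Record sep_state (G : sgraph) (U : {set G}) (l a : nat)
    (D C S : {set G}) (s : seq {set G}) : Prop := SepState {
  sepD : D \subset U;
  sepC : C \subset U;
  sepS : S \subset U;
  sepDC : [disjoint D & C];
  sep_cover : forall x, x \in U ->
    [\/ x \in D, x \in C, x \in S | exists2 A, A \in s & x \in A];
  sep_bags : forall A : {set G}, A \in s ->
    [/\ A \subset U, [disjoint A & C], [disjoint A & D] & #|A| <= a];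
  sep_clique : clique_seq s;
  sep_touch : ~~ touch D C;
  sep_card : l * #|S| <= #|D| }.

Lemma disjoint_setU (T : finType) (A B C : {set T}) :
  [disjoint A :|: B & C] = [disjoint A & C] && [disjoint B & C].
Proof. by rewrite -!setI_eq0 setIUl setU_eq0. Qed.

(** The slow ball joins [D] and its outer layer joins [S]; the ball pays for the layer in
    [sep_card]. *)
Lemma sep_cut (G : sgraph) (U : {set G}) l a D C S s (Z : {set G}) i :
  sep_state U l a D C S s -> Z \subset C ->
  l * #|ball C Z i.+1 :\: ball C Z i| <= #|ball C Z i| ->
  sep_state U l a (D :|: ball C Z i) (C :\: ball C Z i.+1)
            (S :|: (ball C Z i.+1 :\: ball C Z i)) s.
Proof.
move=> st ZC low; have bC j : ball C Z j \subset C := ball_sub j ZC.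
have bU j : ball C Z j \subset U := subset_trans (bC j) (sepC st).
have bS := sub_ballS C Z i.
have DC x : x \in D -> x \notin C by move=> xD; rewrite (disjointFr (sepDC st) xD).
split.
- by rewrite subUset (sepD st) bU.
- by apply: subset_trans (subsetDl _ _) (sepC st).
- by rewrite subUset (sepS st) (subset_trans (subsetDl _ _) (bU _)).
- rewrite -setI_eq0; apply/eqP/setP=> x; rewrite in_setI in_setU in_setD in_set0.
  apply/negP=> /andP[/orP[/DC/negPf xC|xb] /andP[xn]]; first by rewrite xC.
  by rewrite (subsetP bS _ xb) in xn.
- move=> x /(sep_cover st)[xD|xC|xS|xA].
  + by constructor 1; rewrite inE xD.
  + have [xb|xb] := boolP (x \in ball C Z i); first by constructor 1; rewrite inE xb orbT.
    have [xb'|xb'] := boolP (x \in ball C Z i.+1).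
      by constructor 3; rewrite in_setU in_setD xb xb' orbT.
    by constructor 2; rewrite in_setD xb' xC.
  + by constructor 3; rewrite inE xS.
  + by constructor 4.
- move=> A /(sep_bags st)[AU AC AD Aa]; split=> //.
  + exact: disjointWr (subsetDl _ _) AC.
  + rewrite disjoint_sym disjoint_setU ![[disjoint _ & A]]disjoint_sym AD.
    exact: disjointWr AC.
- exact: sep_clique st.
- apply/touchP=> -[x [y [/setUP[xD|xb] /setDP[yC yn] xy]]].
    by have /touchP[] := sep_touch st; exists x, y.
  case/negP: yn; rewrite /= in_setU; apply/orP; right; rewrite inE yC /=.
  by apply/touchP; exists x, y; rewrite set11.
- rewrite [X in _ <= X]cardsU (_ : D :&: ball C Z i = set0) ?cards0 ?subn0.
    apply: leq_trans (leq_add (sep_card st) low); rewrite -mulnDr leq_mul2l.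
    by rewrite leq_card_setU orbT.
  apply/eqP; rewrite setI_eq0; apply: disjointWr (bC i) (sepDC st).
Qed.

(** Only edges between [D] and [C] are forbidden, so a bag without neighbours in [C] can be handed
    to [D] instead of being deleted at the end. *)
Lemma sep_discard (G : sgraph) (U : {set G}) l a D C S s (A : {set G}) :
  sep_state U l a D C S s -> A \in s -> ~~ touch A C ->
  sep_state U l a (D :|: A) C S (rem A s).
Proof.
move=> st As nA; have [AU AC AD _] := sep_bags st As.
have [sc sp] := sep_clique st.
have nd : uniq s.
  have: forall B, B \in s -> B != set0 by move=> B /sc[].
  elim: (s) sp => //= B s' IH /andP[/allP Bs' /IH{}IH] h; apply/andP; split.
    apply/negP=> Bs; have /andP[dB _] := Bs' _ Bs.
    move: dB; rewrite -setI_eq0 setIid => /eqP e.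
    by have := h B (mem_head _ _); rewrite e eqxx.
  by apply: IH => B' Bs; apply: h; rewrite inE Bs orbT.
split.
- by rewrite subUset (sepD st) AU.
- exact: sepC st.
- exact: sepS st.
- by rewrite disjoint_setU AC (sepDC st).
- move=> x /(sep_cover st)[xD|xC|xS|[B Bs xB]].
  + by constructor 1; rewrite inE xD.
  + by constructor 2.
  + by constructor 3.
  + have [e|ne] := eqVneq B A; first by constructor 1; rewrite inE -e xB orbT.
    by constructor 4; exists B; rewrite // mem_rem_uniq // inE ne.
- move=> B; rewrite mem_rem_uniq // inE => /andP[BA Bs].
  have [BU BC BD Ba] := sep_bags st Bs; split=> //.
  rewrite disjoint_sym disjoint_setU ![[disjoint _ & B]]disjoint_sym BD /=.
  have /pairwiseP := sp => /(_ set0) P.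
  have ltB : index B s < size s by rewrite index_mem.
  have ltA : index A s < size s by rewrite index_mem.
  have [lt|lt|e] := ltngtP (index B s) (index A s).
  + by have /andP[] := P _ _ ltB ltA lt; rewrite !nth_index.
  + by have /andP[] := P _ _ ltA ltB lt; rewrite !nth_index // disjoint_sym.
  + by case/eqP: BA; rewrite -(nth_index set0 Bs) e nth_index.
- split; first by move=> B /mem_rem/sc.
  exact: subseq_pairwise (rem_subseq _ _) sp.
- apply/touchP=> -[x [y [/setUP[xD|xA] yC xy]]].
    by have /touchP[] := sep_touch st; exists x, y.
  by case/touchP: nA; exists x, y.
- by apply: leq_trans (sep_card st) _; apply: subset_leq_card; apply: subsetUl.
Qed.

Lemma sep_extend (G : sgraph) (U : {set G}) l a D C S s (Q : {set G}) :
  sep_state U l a D C S s -> Q \subset C -> Q != set0 -> conn_set Q ->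
  #|Q| <= a -> (forall A, A \in s -> touch Q A) ->
  sep_state U l a D (C :\: Q) S (Q :: s).
Proof.
move=> st QC Q0 cQ Qa QA; have [sc sp] := sep_clique st; split.
- exact: sepD st.
- exact: subset_trans (subsetDl _ _) (sepC st).
- exact: sepS st.
- exact: disjointWr (subsetDl _ _) (sepDC st).
- move=> x /(sep_cover st)[xD|xC|xS|[B Bs xB]].
  + by constructor 1.
  + have [xQ|xQ] := boolP (x \in Q); last by constructor 2; rewrite inE xQ xC.
    by constructor 4; exists Q; rewrite ?mem_head.
  + by constructor 3.
  + by constructor 4; exists B; rewrite // inE Bs orbT.
- move=> B; rewrite inE => /orP[/eqP->|/(sep_bags st)[BU BC BD Ba]]; split=> //.
  + exact: subset_trans QC (sepC st).
  + by rewrite -setI_eq0; apply/eqP/setP=> x; rewrite !inE; case: (x \in Q).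
  + by rewrite disjoint_sym; apply: disjointWr QC (sepDC st).
  + exact: disjointWr (subsetDl _ _) BC.
- split; first by move=> B; rewrite inE => /orP[/eqP->|/sc].
  rewrite /= sp andbT; apply/allP=> B Bs; rewrite QA // andbT.
  have [_ BC _ _] := sep_bags st Bs.
  by rewrite disjoint_sym; apply: disjointWr QC BC.
- apply: contra (sep_touch st) => /touchP[x [y [xD /setDP[yC _] xy]]].
  by apply/touchP; exists x, y.
- exact: sep_card st.
Qed.

Lemma card_bigcup_seq (T : finType) (s : seq {set T}) a :
  (forall A, A \in s -> #|A| <= a) -> #|\bigcup_(A <- s) A| <= size s * a.
Proof.
elim: s => [|A s IH] h; first by rewrite big_nil cards0.
rewrite big_cons mulSn; apply: leq_trans (leq_card_setU _ _) _.
apply: leq_add; first by apply: h; apply: mem_head.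
by apply: IH => B Bs; apply: h; rewrite inE Bs orbT.
Qed.

(** The new bag is a spider centred at [v]: one leg per old bag, made of two short ball paths that
    meet at [w], the second starting at a neighbour of that bag. *)
Lemma hub_exists (G : sgraph) (C : {set G}) (s : seq {set G}) v k :
  v \in C ->
  (forall A : {set G}, A \in s ->
    exists2 w, w \in ball C [set v] k &
               w \in ball C [set y in C | touch A [set y]] k) ->
  exists Q : {set G}, [/\ Q \subset C, conn_set Q, v \in Q,
    #|Q| <= 1 + size s * (k.+1 + k.+1) & forall A, A \in s -> touch Q A].
Proof.
move=> vC; elim: s => [_|A s IH hA].
  exists [set v]; rewrite sub1set vC set11 cards1.
  by split=> //; apply: conn_set1.
have [Q [QC cQ vQ Qk QA]] := IH (fun B Bs => hA B (mem_behead (s := A :: s) Bs)).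
have [w wv wA] := hA A (mem_head _ _).
have ZC : [set y in C | touch A [set y]] \subset C.
  by apply/subsetP=> y; rewrite inE => /andP[].
have [Q1 [Q1C cQ1 wQ1 Q1k [z /set1P-> vQ1]]] := ball_path (introT subsetP
  (fun x (xv : x \in [set v]) => eq_ind_r (fun x => x \in C) vC (set1P xv))) wv.
have [Q2 [Q2C cQ2 wQ2 Q2k [u]]] := ball_path ZC wA.
rewrite inE => /andP[uC /touchP[x [_ [xA /set1P-> xu]]]] uQ2.
exists (Q :|: (Q1 :|: Q2)); split.
- by rewrite !subUset QC Q1C.
- apply: (conn_setU vQ _ cQ); first by rewrite inE vQ1.
  exact: conn_setU wQ1 wQ2 cQ1 cQ2.
- by rewrite inE vQ.
- rewrite mulSn addnCA addnC; apply: leq_trans (leq_card_setU _ _) _.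
  apply: leq_add Qk _; apply: leq_trans (leq_card_setU _ _) _; exact: leq_add.
- move=> B; rewrite inE => /orP[/eqP->|/QA/touchP[y [y' [yQ y'B yy']]]].
    by apply/touchP; exists u, x; rewrite adj_sym xu xA !inE uQ2 !orbT.
  by apply/touchP; exists y, y'; rewrite inE yQ.
Qed.

(** Termination: every step increases [#|D| * t.+1 + size s]. A cut or a discarded bag enlarges [D],
    which outweighs the loss of a bag, and an extension adds a bag. [N] bounds the remaining
    increase. *)
Lemma separator_rec (G : sgraph) (U : {set G}) t l k a N :
  (forall s : seq {set G}, clique_seq s -> size s < t) ->
  10 <= l -> l ^ k * #|U| < l.+1 ^ k ->
  a = t * (k.+1 + k.+1) -> 0 < #|U| -> 10 * (t * a) <= #|U| ->
  forall D C S s, sep_state U l a D C S s -> 10 * #|D| <= 7 * #|U| ->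
  #|U| * t.+1 + t <= #|D| * t.+1 + size s + N ->
  exists D C S : {set G},
    [/\ U = D :|: C :|: S, ~~ touch D C, [disjoint D & C],
        10 * #|D| <= 9 * #|U| & 10 * #|C| <= 9 * #|U| /\
        l * #|S| <= #|U| + l * (t * a)].
Proof.
move=> noK l10 lk aE U0 tU; elim: N => [|N IH] D C S s st D7 meas.
  have := noK _ (sep_clique st); have := subset_leq_card (sepD st).
  by move: meas; nia.
have st_lt := noK _ (sep_clique st).
have cover : U :\: D :\: C \subset S :|: \bigcup_(A <- s) A.
  apply/subsetP=> x /setDP[/setDP[xU xD] xC].
  have [xD'|xC'|xS|[A As xA]] := sep_cover st xU.
  - by rewrite xD' in xD.
  - by rewrite xC' in xC.
  - by rewrite inE xS.
  - by rewrite inE (big_rem _ As) /= inE xA orbT.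
have bags : #|\bigcup_(A <- s) A| <= t * a.
  apply: leq_trans (card_bigcup_seq (a := a) _) _.
    by move=> A /(sep_bags st)[].
  by rewrite leq_mul2r (ltnW st_lt) orbT.
have restS : #|U :\: D :\: C| <= #|S| + t * a.
  apply: leq_trans (subset_leq_card cover) _.
  by apply: leq_trans (leq_card_setU _ _) _; rewrite leq_add2l.
have UDC : #|U| = #|D| + #|C| + #|U :\: D :\: C|.
  rewrite -addnA -(cardsID D U) (setIidPr (sepD st)); congr (_ + _).
  rewrite -(cardsID C (U :\: D)); congr (_ + _).
  congr (#|pred_of_set _|); apply/setIidPr; rewrite subsetD (sepC st) disjoint_sym.
  exact: sepDC st.
have DU := subset_leq_card (sepD st).
(* The search stops once [D] has a tenth of [U]. Before that, a cut adds at most half of [C] and a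
   discarded bag at most a tenth of [U], so [D] cannot jump beyond 7/10. *)
case: (leqP #|U| (10 * #|D|)) => [Dbig|Dsmall].
  exists D, C, (U :\: D :\: C); split.
  - apply/setP=> x; rewrite !inE; have := subsetP (sepD st) x.
    have := subsetP (sepC st) x.
    by case: (x \in D) => [_ ->|]//; case: (x \in C) => [->|].
  - exact: sep_touch st.
  - exact: sepDC st.
  - lia.
  - split; first by lia.
    have := leq_mul (leqnn l) restS; rewrite mulnDr.
    by have := sep_card st; lia.
have [A /andP[As nA]|allT] := pickP [pred A | (A \in s) && ~~ touch A C].
  have [AU AC AD Aa] := sep_bags st As.
  have cDA : #|D :|: A| = #|D| + #|A|.
    rewrite cardsU (_ : D :&: A = set0) ?cards0 ?subn0 //.
    by apply/eqP; rewrite setI_eq0 disjoint_sym.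
  have A0 : 0 < #|A|.
    by rewrite card_gt0; have [sc _] := sep_clique st; have [] := sc _ As.
  have s0 : 0 < size s by case: (s) As.
  apply: (IH _ _ _ _ (sep_discard st As nA)); rewrite cDA ?size_rem //.
    by have := leq_pmull a (leq_trans s0 (ltnW st_lt)); lia.
  by move: meas; nia.
have Sl : 10 * #|S| <= #|D|.
  by apply: leq_trans (sep_card st); rewrite leq_mul2r l10 orbT.
have Cgt0 : 0 < #|C| by lia.
have CU := subset_leq_card (sepC st).
have lkC : l ^ k * #|C| < l.+1 ^ k by apply: leq_ltn_trans lk; rewrite leq_mul2l CU orbT.
have cut (Z : {set G}) i : Z \subset C -> Z != set0 -> 2 * #|ball C Z i| <= #|C| ->
    l * #|ball C Z i.+1 :\: ball C Z i| <= #|ball C Z i| ->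
    exists D C S : {set G},
    [/\ U = D :|: C :|: S, ~~ touch D C, [disjoint D & C],
        10 * #|D| <= 9 * #|U| & 10 * #|C| <= 9 * #|U| /\
        l * #|S| <= #|U| + l * (t * a)].
  move=> ZC Z0 half low.
  have cDB : #|D :|: ball C Z i| = #|D| + #|ball C Z i|.
    rewrite cardsU (_ : D :&: _ = set0) ?cards0 ?subn0 //.
    by apply/eqP; rewrite setI_eq0; apply: disjointWr (ball_sub i ZC) (sepDC st).
  have B0 : 0 < #|ball C Z i|.
    apply: leq_trans (subset_leq_card (sub_ball C Z (leq0n i))).
    by rewrite card_gt0.
  apply: (IH _ _ _ _ (sep_cut st ZC low)); rewrite cDB; first by lia.
  by move: meas; nia.
have /card_gt0P[v vC] := Cgt0.
have vC1 : [set v] \subset C by rewrite sub1set.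
have v0 : [set v] != set0 by apply/set0Pn; exists v; rewrite set11.
have [vbig|[i [half low]]] := ball_growth vC1 v0 lkC; last exact: cut low.
pose Z (A : {set G}) := [set y in C | touch A [set y]].
have ZC A : Z A \subset C by apply/subsetP=> y; rewrite inE => /andP[].
have Z0 A : A \in s -> Z A != set0.
  move=> As; have := allT A; rewrite /= As => /negbT; rewrite negbK.
  case/touchP=> x [y [xA yC xy]]; apply/set0Pn; exists y; rewrite inE yC.
  by apply/touchP; exists x, y; rewrite set11.
have [/hasP[A As Asmall]|/hasPn allbig] :=
  boolP (has (fun A => 2 * #|ball C (Z A) k| <= #|C|) s).
  have [Abig|[i [half low]]] := ball_growth (ZC A) (Z0 A As) lkC.
    by move: Asmall; rewrite leqNgt Abig.
  exact: cut (ZC A) (Z0 A As) half low.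
(* All balls now fill more than half of [C], so any two of them meet. *)
have [|Q [QC cQ vQ Qk QA]] := @hub_exists G C s v k vC.
  move=> A As; have := allbig A As; rewrite -ltnNge => Abig.
  have [|w /setIP[wv wA]] := set0Pn (ball C [set v] k :&: ball C (Z A) k) _; last by exists w.
  rewrite -card_gt0; have := cardsUI (ball C [set v] k) (ball C (Z A) k).
  have /subset_leq_card : ball C [set v] k :|: ball C (Z A) k \subset C.
    by rewrite subUset !ball_sub.
  lia.
have Qa : #|Q| <= a.
  rewrite aE; apply: leq_trans Qk _; case: (t) st_lt => // t'; rewrite ltnS => st'.
  by rewrite mulSn leq_add // leq_mul2r st' orbT.
have Q0 : Q != set0 by apply/set0Pn; exists v.
by apply: (IH _ _ _ _ (sep_extend st QC Q0 cQ Qa QA)) => //=; lia.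
Qed.

Lemma separator (G : sgraph) (U : {set G}) t l k :
  (forall s : seq {set G}, clique_seq s -> size s < t) ->
  10 <= l -> l ^ k * #|U| < l.+1 ^ k -> 0 < #|U| ->
  10 * (t * (t * (k.+1 + k.+1))) <= #|U| ->
  exists D C S : {set G},
    [/\ U = D :|: C :|: S, ~~ touch D C, [disjoint D & C],
        10 * #|D| <= 9 * #|U| & 10 * #|C| <= 9 * #|U| /\
        l * #|S| <= #|U| + l * (t * (t * (k.+1 + k.+1)))].
Proof.
move=> noK l10 lk U0 tU.
apply: (separator_rec (D := set0) (C := U) (S := set0) (s := [::])
  (N := #|U| * t.+1 + t) noK l10 lk erefl U0 tU).
- split; rewrite ?sub0set ?cards0 ?muln0 //.
  + by rewrite -setI_eq0 set0I.
  + by move=> x xU; constructor 2.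
  + by apply/touchP=> -[x [y []]]; rewrite inE.
- by rewrite cards0 muln0.
- by rewrite leq_addl.
Qed.

(** * Fans *)

Lemma mem_edges (G : sgraph) (E : {set G}) :
  reflect (exists x y, adj x y /\ E = [set x; y]) (E \in edges G).
Proof.
apply: (iffP imsetP) => [[[x y] /=]|[x [y [xy ->]]]].
  by rewrite inE /= => xy ->; exists x, y.
by exists (x, y); rewrite ?inE.
Qed.

Lemma sum_adj_edges (G : sgraph) :
  \sum_(x : G) \sum_(y : G) (adj x y : nat) <= 2 * #|edges G|.
Proof.
rewrite pair_bigA /=.
have -> : \sum_(p : G * G) (adj p.1 p.2 : nat) = \sum_(p : G * G | adj p.1 p.2) 1.
  by rewrite [RHS]big_mkcond; apply: eq_bigr => p _; case: adj.
rewrite (partition_big (fun p : G * G => [set p.1; p.2]) (mem (edges G))) /=; last first.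
  by move=> p pG; apply/mem_edges; exists p.1, p.2.
rewrite mulnC -sum_nat_const; apply: leq_sum => E /mem_edges[x [y [_ ->]]].
rewrite sum1_card; apply: (@leq_trans #|[set (x, y); (y, x)]|); last first.
  by rewrite cards2 ltnS leq_b1.
apply: subset_leq_card; apply/subsetP=> -[a b]; rewrite unfold_in /= => /andP[ab /eqP e].
have ne : a != b by apply: contraTneq ab => ->; rewrite adj_irr.
have aE : a \in [set x; y] by rewrite -e set21.
have bE : b \in [set x; y] by rewrite -e set22.
rewrite !inE !xpair_eqE; move: aE bE ne; rewrite !inE.
by move=> /orP[]/eqP-> /orP[]/eqP-> ; rewrite !eqxx ?orbT.
Qed.

Section Fan.
Variables (S : finType) (H : sgraph) (aS : S -> H -> bool) (k : nat).

(** The pattern [aS] is the same for all [k] copies, so properties of a single copy control the fan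
    for every [k]. *)
Definition fan_adj (x y : S + 'I_k * H) : bool :=
  match x, y with
  | inl v, inr p | inr p, inl v => aS v p.2
  | inr p, inr p' => (p.1 == p'.1) && adj p.2 p'.2
  | inl _, inl _ => false
  end.

Fact fan_sym : symmetric fan_adj.
Proof. by move=> [v|p] [v'|p'] //=; rewrite eq_sym adj_sym. Qed.

Fact fan_irr : irreflexive fan_adj.
Proof. by move=> [v|p] //=; rewrite adj_irr andbF. Qed.

Definition fan : sgraph := SGraph fan_sym fan_irr.

Lemma card_fan : #|fan| = #|S| + k * #|H|.
Proof. by rewrite card_sum card_prod card_ord. Qed.

Lemma fan_edges :
  k * (2 * (\sum_(v : S) \sum_(h : H) aS v h) + \sum_(h : H) \sum_(h' : H) adj h h')
    <= 2 * #|edges fan|.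
Proof.
apply: leq_trans (sum_adj_edges fan).
have sumT (F : fan -> nat) :
    \sum_x F x = \sum_(v : S) F (inl v) + \sum_(p : 'I_k * H) F (inr p).
  exact: big_sumType.
have -> : \sum_(x : fan) \sum_(y : fan) (adj x y : nat) =
    \sum_(v : S) \sum_(p : 'I_k * H) aS v p.2 +
    \sum_(p : 'I_k * H) (\sum_(v : S) aS v p.2 +
      \sum_(p' : 'I_k * H) ((p.1 == p'.1) && adj p.2 p'.2)).
  rewrite sumT; congr (_ + _); apply: eq_bigr => ? _; rewrite sumT //=.
  by rewrite big1.
have sumk (F : H -> nat) : \sum_(p : 'I_k * H) F p.2 = k * \sum_h F h.
  rewrite -(pair_bigA _ (fun (c : 'I_k) h => F h)) /=.
  by rewrite sum_nat_const card_ord.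
have SE : \sum_(v : S) \sum_(p : 'I_k * H) aS v p.2 = k * \sum_v \sum_h aS v h.
  by rewrite big_distrr; apply: eq_bigr => v _; exact: (sumk (fun h => aS v h : nat)).
rewrite big_split /= [X in _ <= _ + (X + _)]exchange_big /= SE.
rewrite mulnDr mulnCA mul2n -addnn -addnA !leq_add2l.
rewrite -(sumk (fun h => \sum_h' adj h h')); apply: leq_sum => -[c h] _ /=.
rewrite -(pair_bigA _ (fun c' h' => nat_of_bool ((c == c') && adj h h'))) /=.
by rewrite (bigD1 c) //= eqxx leq_addr.
Qed.

Variables (l r q : nat).
Hypotheses (l0 : 0 < l) (q0 : 0 < q) (qr : q <= r) (Sl : #|S| <= l * (r - q)).

(* Some copy of [K_r] meets [S] in at most [r - q] vertices, so [q] of its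
   branch sets avoid [S]; being connected and pairwise adjacent, these lie in
   a single copy of [H]. *)
Lemma fan_model : minor (copies l (complete_graph r)) fan ->
  exists (f : {ffun H -> option 'I_r}) (g : {ffun S -> option 'I_r}) (Y : {set 'I_r}),
  [/\ #|Y| = q, #|[set v | g v != None]| <= r - q,
      forall a, a \in Y -> exists h, f h = Some a &
      forall a b, a \in Y -> b \notin Y ->
        (exists h h', [/\ f h = Some a, f h' = Some b & adj h h']) \/
        (exists h v, [/\ f h = Some a, g v = Some b & aS v h])].
Proof.
case/minor_model=> F [Fs Fc Fa].
pose hit (i : 'I_l) (v : S) := if F (inl v) is Some p then p.1 == i else false.
have [i hi] : exists i, #|[set v | hit i v]| <= r - q.
  apply/existsP; apply: contraT => /existsPn h; exfalso.
  have : \sum_(i < l) (r - q).+1 <= \sum_(i < l) #|[set v | hit i v]|.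
    by apply: leq_sum => i _; rewrite ltnNge h.
  rewrite sum_nat_const card_ord.
  have -> : \sum_(i < l) #|[set v | hit i v]| = \sum_v \sum_(i < l) hit i v.
    rewrite exchange_big /=; apply: eq_bigr => i _; rewrite -sum1_card big_mkcond.
    by apply: eq_bigr => v _; rewrite inE; case: (hit i v).
  have : \sum_v \sum_(i < l) hit i v <= \sum_(v : S) 1.
    apply: leq_sum => v _; rewrite /hit; case: (F (inl v)) => [[i b]|] /=.
      rewrite (bigD1 i) //= eqxx big1 // => i' /negPf ii'.
      by rewrite eq_sym ii'.
    by rewrite big1.
  have -> : \sum_(v : S) 1 = #|S| by rewrite sum1_card.
  move=> h1 h2; have := leq_trans h2 (leq_trans h1 Sl).
  by rewrite leq_pmul2l // ltnn.
pose own (x : fan) := if F x is Some p then if p.1 == i then Some p.2 else None else None.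
have ownE x a : (own x == Some a) = (F x == Some (i, a)).
  rewrite /own; case: (F x) => [[i' b]|] //=.
  case: (eqVneq i' i) => [->|ii']; first by rewrite !(inj_eq Some_inj) xpair_eqE eqxx.
  by rewrite (inj_eq Some_inj) xpair_eqE (negPf ii').
pose g := [ffun v => own (inl v)].
have gdom : #|[set v | g v != None]| <= r - q.
  apply: leq_trans hi; apply: subset_leq_card; apply/subsetP=> v.
  rewrite !inE ffunE /own /hit; case: (F (inl v)) => [p|//].
  by case: (p.1 == i).
pose Y0 := ~: [set a | [exists v, g v == Some a]].
have Y0q : q <= #|Y0|.
  suff : #|[set a | [exists v, g v == Some a]]| <= r - q.
    by have := cardsC [set a | [exists v, g v == Some a]]; rewrite -/Y0 card_ord; lia.
  apply: leq_trans gdom.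
  apply: leq_trans (leq_imset_card (fun v => odflt (Ordinal (leq_trans q0 qr)) (g v)) _).
  apply: subset_leq_card; apply/subsetP=> a; rewrite inE => /existsP[v /eqP ga].
  by apply/imsetP; exists v; rewrite ?inE ga.
have /card_geqP[sY [uY szY sYY]] := Y0q.
pose Y := [set a in sY].
have YY a : a \in Y -> a \in Y0 by rewrite inE => /sYY.
have inlY a v : a \in Y -> F (inl v) = Some (i, a) -> False.
  move=> /YY; rewrite !inE => /existsPn/(_ v) nv e; case/negP: nv.
  by rewrite ffunE ownE e.
have same a c h c' h' : a \in Y -> F (inr (c, h)) = Some (i, a) ->
    F (inr (c', h')) = Some (i, a) -> c = c'.
  move=> aY e e'; apply/eqP; apply: contraT => cc'.
  pose X := [set x : fan | (F x == Some (i, a)) && if x is inr p then p.1 == c else false].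
  have [] := Fc (i, a) X.
  - by apply/subsetP=> x; rewrite !inE => /andP[].
  - by apply/set0Pn; exists (inr (c, h)); rewrite inE e !eqxx.
  - apply: contraNneq cc' => eX; have : (inr (c', h') : fan) \in X by rewrite eX inE e'.
    by rewrite inE => /andP[_]; rewrite eq_sym.
  move=> [v|p] [[v'|p'] []]; rewrite !inE /= ?andbF // => /andP[/eqP Fp /eqP pc].
    by move=> /andP[_ /eqP Fv']; case: (inlY _ _ aY Fv').
  move=> /andP[n /eqP Fp'] /andP[/eqP pp' _].
  by move: n; rewrite Fp' -pp' pc !eqxx.
have uYc : #|Y| = q by rewrite cardsE (card_uniqP uY).
have /card_gt0P[a0 a0Y] : 0 < #|Y| by rewrite uYc.
have [[v0 e0|[c0 h0] e0]] := Fs (i, a0); first by case: (inlY _ _ a0Y e0).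
have pairs a b : a != b -> exists x y, [/\ F x = Some (i, a), F y = Some (i, b) & adj x y].
  by move=> ab; apply: Fa; rewrite /= /copies_adj /= eqxx.
have inc0 a c h : a \in Y -> F (inr (c, h)) = Some (i, a) -> c = c0.
  move=> aY e; have [aa0|aa0] := eqVneq a a0.
    by rewrite aa0 in e; exact: same a0Y e e0.
  have [[v|[c1 h1]] [[v'|[c2 h2]] [e1 e2 /=]]] := pairs _ _ aa0.
  - by case: (inlY _ _ aY e1).
  - by case: (inlY _ _ aY e1).
  - by case: (inlY _ _ a0Y e2).
  case/andP=> /eqP c12 _; rewrite (same _ _ _ _ _ aY e e1) c12.
  exact: same a0Y e2 e0.
exists [ffun h => own (inr (c0, h))], g, Y; split=> //.
- move=> a aY; have [[v|[c h]] e] := Fs (i, a); first by case: (inlY _ _ aY e).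
  by exists h; apply/eqP; rewrite ffunE ownE -(inc0 _ _ _ aY e) e.
- move=> a b aY bY; have ab : a != b by apply: contraNneq bY => <-.
  have [[v|[c h]] [y [e1 e2 xy]]] := pairs _ _ ab; first by case: (inlY _ _ aY e1).
  have cE := inc0 _ _ _ aY e1; subst c.
  have fh : [ffun h => own (inr (c0, h))] h = Some a.
    by apply/eqP; rewrite ffunE ownE e1.
  case: y e2 xy => [v|[c' h']] e2 /= xy.
    by right; exists h, v; split=> //; apply/eqP; rewrite ffunE ownE e2.
  case/andP: xy => /eqP cc' hh'; subst c'; left; exists h, h'; split=> //.
  by apply/eqP; rewrite ffunE ownE e2.
Qed.

End Fan.

(** * Dense subgraphs of prescribed order *)

Lemma bernoulli_nat l k : l ^ k * (l + k) <= l.+1 ^ k * l.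
Proof.
elim: k => [|k IH]; first by rewrite !expn0 addn0.
rewrite !expnS; apply: (@leq_trans (l.+1 * (l ^ k * (l + k)))); last first.
  by rewrite -mulnA leq_mul2l IH.
by rewrite mulnCA [l * _]mulnC -mulnA leq_mul2l; apply/orP; right; nia.
Qed.

Lemma double_exp_succ l : 0 < l -> 2 * l ^ l <= l.+1 ^ l.
Proof.
move=> l0; have := bernoulli_nat l l.
by rewrite addnn -mul2n mulnA leq_pmul2r // mulnC.
Qed.

Lemma leq_expl e m n : m <= n -> m ^ e <= n ^ e.
Proof. by case: e => // e mn; rewrite leq_exp2r. Qed.

(** Split [2 ^ w] into two factors [2 ^ u] with [u] half of [w]: one absorbs a factor [u], the other
    the remaining power, by induction. *)
Lemma poly_exp2 c d : exists w0, forall w, w0 <= w -> c * w ^ d <= 2 ^ w.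
Proof.
elim: d c => [|d IH] c.
  exists c => w cw; rewrite expn0 muln1; apply: leq_trans cw _.
  exact: ltnW (ltn_expl _ _).
have [u0 Hu] := IH (c * 3 ^ d.+1); exists (2 * u0 + 2) => w w0.
pose u := w./2; have wE : w = odd w + u.*2 by rewrite odd_double_half.
have uge : u0 <= u /\ 0 < u by have := leq_b1 (odd w); lia.
have w3 : w <= 3 * u by have := leq_b1 (odd w); lia.
apply: (@leq_trans (c * (3 * u) ^ d.+1)); first by rewrite leq_mul2l leq_exp2r // w3 orbT.
apply: (@leq_trans (2 ^ u * 2 ^ u)); last first.
  by rewrite -expnD leq_exp2l // addnn wE leq_addl.
rewrite expnMn (expnS u) (mulnCA _ u) mulnCA mulnC mulnA.
apply: leq_mul; last exact: ltnW (ltn_expl _ _).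
exact: Hu (proj1 uge).
Qed.

Lemma separator_log t : exists w0, forall (G : sgraph) (U : {set G}),
  (forall s : seq {set G}, clique_seq s -> size s < t) ->
  w0 <= trunc_log 2 #|U| ->
  exists D C S : {set G},
    [/\ U = D :|: C :|: S, ~~ touch D C, [disjoint D & C],
        10 * #|D| <= 9 * #|U| & 10 * #|C| <= 9 * #|U| /\
        trunc_log 2 #|U| ^ 2 * #|S| <= #|U|].
Proof.
have [w1 Hw] := poly_exp2 (20 * (t * t)) 5; exists (w1 + 3) => G U noK.
set w := trunc_log 2 #|U| => w0.
have w3 : 3 <= w by lia.
have U0 : 0 < #|U|.
  by case: (posnP #|U|) => // e; move: w3; rewrite /w e trunc_log0.
have Ulo : 2 ^ w <= #|U| by apply: trunc_logP.
have Uhi : #|U| < 2 ^ w.+1 by apply: trunc_log_ltn.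
have poly := leq_trans (Hw w (leq_trans (leq_addr _ _) w0)) Ulo.
(* [k] gives [(1 + 1/l)^k >= 2^(w+1) > #|U|]. The layers and the bags each take at most
   [#|U| / (2 w^2)] vertices; for the bags this needs [l * T <= #|U|], where [T] is of order [w^3],
   hence the fifth power in [Hw]. *)
pose l := 2 * w ^ 2; pose k := l * w.+1; pose T := t * (t * (k.+1 + k.+1)).
have ww : 9 <= w ^ 2 by rewrite -[9]/(3 ^ 2) leq_exp2r.
have l10 : 10 <= l by rewrite /l; lia.
have w53 : w ^ 5 = w ^ 2 * w ^ 3 by rewrite -expnD.
have w32 : w ^ 3 = w * w ^ 2 by rewrite -expnS.
have lT : l * T <= #|U|.
  apply: leq_trans poly; rewrite w53 /l /T /k /l.
  have : (2 * w ^ 2 * w.+1).+1 + (2 * w ^ 2 * w.+1).+1 <= 10 * w ^ 3.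
    by rewrite w32; move: (w ^ 2) ww => z; nia.
  set x := _ + _ => xb.
  have -> : 20 * (t * t) * (w ^ 2 * w ^ 3) = 2 * w ^ 2 * (t * (t * (10 * w ^ 3))) by lia.
  by rewrite !leq_mul2l xb !orbT.
have lk : l ^ k * #|U| < l.+1 ^ k.
  apply: (@leq_trans (l ^ k * 2 ^ w.+1)).
    by rewrite ltn_mul2l Uhi expn_gt0; have -> : 0 < l by lia.
  rewrite /k [l ^ _]expnM [l.+1 ^ _]expnM mulnC -expnMn leq_exp2r //.
  by apply: double_exp_succ; lia.
have [|D [C [S [UE nt dDC D9 [C9 lS]]]]] := separator noK l10 lk U0.
  by rewrite -/T; apply: leq_trans lT; rewrite leq_mul2r l10 orbT.
exists D, C, S; split=> //; split=> //.
by move: lS; rewrite -/T /l -!mulnA; move: lT; rewrite /l -!mulnA; lia.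
Qed.

(** * Edge covers by pieces of bounded size *)

Local Open Scope ring_scope.

(** [k] bounds the rounds still to come, as a round shrinks sizes by the factor 19/20. The separator
    goes into both parts so that no edge is lost; only its vertices are repeated, and [g]
    accumulates the factors that this costs. *)
Lemma pieces_rec (R : realFieldType) w0 A (g : nat -> R) (G : sgraph) :
  (forall (U : {set G}), (w0 <= trunc_log 2 #|U|)%N ->
    exists D C S : {set G},
    [/\ U = D :|: C :|: S, ~~ touch D C, [disjoint D & C],
        (10 * #|D| <= 9 * #|U|)%N & (10 * #|C| <= 9 * #|U|)%N /\
        (trunc_log 2 #|U| ^ 2 * #|S| <= #|U|)%N]) ->
  (w0 <= A)%N -> (5 <= A)%N -> 1 <= g 0%N ->
  (forall k w, (0 < w)%N -> (19 * A + k <= 19 * w + 18)%N ->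
     g k * (1 + 2 / w%:R ^+ 2) <= g k.+1) ->
  forall k (U : {set G}), (#|U| * 19 ^ k <= 2 ^ A * 20 ^ k)%N ->
  exists s : seq {set G},
    [/\ forall V, V \in s -> (#|V| <= 2 ^ A)%N,
        forall x y, x \in U -> y \in U -> adj x y ->
          exists V, [/\ V \in s, x \in V & y \in V] &
        (\sum_(V <- s) #|V|)%:R <= g k * #|U|%:R].
Proof.
move=> sep wA A5 g0 gS.
have gm k : 1 <= g k /\ g k <= g k.+1.
  elim: k => [|k [g1 gk]].
    split=> //; apply: le_trans (gS 0%N A _ _); [|lia|lia].
    by rewrite ler_peMr ?(le_trans ler01) // lerDl divr_ge0 ?exprn_ge0 ?ler0n.
  have g1' := le_trans g1 gk; split=> //.
  apply: le_trans (gS k.+1 (A + k.+1)%N _ _); [|lia|lia].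
  by rewrite ler_peMr ?(le_trans ler01) // lerDl divr_ge0 ?exprn_ge0 ?ler0n.
elim=> [|k IH] U.
  rewrite !expn0 !muln1 => UA; exists [:: U]; split.
  - by move=> V; rewrite inE => /eqP->.
  - by move=> x y xU yU _; exists U; rewrite inE eqxx.
  - by rewrite big_seq1 ler_peMl // ler0n.
move=> Uk; case: (leqP (#|U| * 19 ^ k) (2 ^ A * 20 ^ k)) => [/IH|big].
  case=> s [sA sE sS]; exists s; split=> //; apply: le_trans sS _.
  by rewrite ler_wpM2r ?ler0n //; case: (gm k).
set w := trunc_log 2 #|U|.
(* Since [(20/19)^19 >= 2], 19 rounds change the logarithm by at least one. The rounding in
   [k %/ 19] is the origin of the 18 in the hypothesis on [g]. *)
have wbig : (A + k %/ 19 <= w)%N.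
  apply: trunc_log_max => //; rewrite expnD.
  suff : (2 ^ (k %/ 19) * 19 ^ k <= 20 ^ k)%N.
    move=> h; have := leq_mul (leqnn (2 ^ A)) h => h2.
    rewrite -(@leq_pmul2r (19 ^ k)) ?expn_gt0 // -mulnA.
    exact: leq_trans h2 (ltnW big).
  rewrite {2 3}(divn_eq k 19) !expnD mulnA.
  apply: leq_mul; last by apply: leq_expl.
  by rewrite mulnC ![(_ * 19)%N]mulnC !expnM -expnMn mulnC; apply: leq_expl; exact: double_exp_succ.
have [|D [C [S [UE nt dDC D9 [C9 wS]]]]] := sep U.
  by apply: leq_trans wA _; apply: leq_trans wbig; apply: leq_addr.
have w5 : (5 <= w)%N by lia.
have SU : (25 * #|S| <= #|U|)%N.
  apply: leq_trans wS; rewrite leq_mul2r; apply/orP; right.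
  by rewrite -[25%N]/(5 ^ 2)%N leq_exp2r.
(* Here [9/10 + 1/25 < 19/20]. *)
have part (P : {set G}) : (10 * #|P| <= 9 * #|U|)%N ->
    (#|P :|: S| * 19 ^ k <= 2 ^ A * 20 ^ k)%N.
  move=> P9; have PS : (#|P :|: S| <= #|P| + #|S|)%N := leq_card_setU P S.
  have /leq_mul/(_ (leqnn (19 ^ k))) : (20 * #|P :|: S| <= 19 * #|U|)%N by lia.
  by move: Uk; rewrite !expnS; move: (19 ^ k)%N (20 ^ k)%N (2 ^ A)%N; nia.
have [s1 [s1A s1E s1S]] := IH _ (part _ D9).
have [s2 [s2A s2E s2S]] := IH _ (part _ C9).
exists (s1 ++ s2); split.
- by move=> V; rewrite mem_cat => /orP[/s1A|/s2A].
- have inU z : z \in U -> [|| z \in D, z \in C | z \in S].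
    by rewrite UE !inE orbA.
  have noDC a b : a \in D -> b \in C -> ~ adj a b.
    by move=> aD bC ab; case/touchP: nt; exists a, b.
  move=> x y /inU xU /inU yU xy.
  have xy' : adj y x by rewrite adj_sym.
  have [/andP[x1 y1]|n1] := boolP ((x \in D :|: S) && (y \in D :|: S)).
    by have [V [Vs xV yV]] := s1E _ _ x1 y1 xy; exists V; rewrite mem_cat Vs.
  have [/andP[x1 y1]|n2] := boolP ((x \in C :|: S) && (y \in C :|: S)).
    by have [V [Vs xV yV]] := s2E _ _ x1 y1 xy; exists V; rewrite mem_cat Vs orbT.
  exfalso; move: n1 n2 xU yU; rewrite !inE.
  case xD: (x \in D); case yD: (y \in D); case xC: (x \in C); case yC: (y \in C);
  case: (x \in S); case: (y \in S) => //= _ _ _ _;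
  solve [exact: (noDC _ _ xD yC) | exact: (noDC _ _ yD xC)].
- rewrite big_cat /= natrD.
  have gk1 := (gm k).1.
  apply: (@le_trans _ _ (g k * (#|U|%:R * (1 + 2 / w%:R ^+ 2)))).
    apply: le_trans (lerD s1S s2S) _; rewrite -mulrDr ler_wpM2l //.
      exact: le_trans ler01 gk1.
    have DC : (#|D| + #|C| <= #|U|)%N.
      have -> : (#|D| + #|C| = #|D :|: C|)%N.
        rewrite cardsU (_ : D :&: C = set0) ?cards0 ?subn0 //.
        by apply/eqP; rewrite setI_eq0.
      by apply: subset_leq_card; rewrite UE subsetUl.
    have : (#|D :|: S| + #|C :|: S| <= #|U| + 2 * #|S|)%N.
      by have := (leq_card_setU D S).1; have := (leq_card_setU C S).1; lia.
    rewrite -(ler_nat R) natrD => /le_trans; apply.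
    rewrite mulrDr mulr1 natrD lerD2l natrM mulrCA ler_wpM2l //.
    rewrite ler_pdivlMr ?exprn_gt0 ?ltr0n //; last by lia.
    by rewrite -natrX -natrM ler_nat mulnC.
  rewrite mulrCA mulrC ler_wpM2r ?ler0n // gS //; lia.
Qed.

(* Bound on the multiplicity of the vertices in the pieces after [k] rounds of
   separations. Round [k] costs a factor at most [1 + 2 / w ^ 2] with
   [w >= (B + k) / 19], and the sum of [722 / (B + k) ^ 2] telescopes against
   [1500 / (B + k)]. *)
Definition piece_loss (R : realFieldType) (B k : nat) : R :=
  1 + 1500 * ((B%:R - 1)^-1 - (B%:R + k%:R - 1)^-1).

Lemma piece_loss_step (R : realFieldType) (B k w : nat) :
  (1502 <= B)%N -> (0 < w)%N -> (B + k <= 19 * w)%N ->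
  piece_loss R B k * (1 + 2 / w%:R ^+ 2) <= piece_loss R B k.+1.
Proof.
move=> B0 w0 Bw; rewrite /piece_loss.
set b : R := B%:R; set y : R := b + k%:R.
have -> : b + k.+1%:R - 1 = y by rewrite /y -natr1; lra.
have b1 : 1502 <= b by rewrite /b (ler_nat R 1502).
have yb : b <= y by rewrite /y lerDl ler0n.
have yw : y <= 19 * w%:R by rewrite /y /b -natrD -(natrM R 19) ler_nat.
have w0' : 0 < w%:R :> R by rewrite ltr0n.
have hb : (b - 1)^-1 <= 1 / 1500.
  by rewrite div1r lef_pV2 ?posrE; lra.
have hy : 0 <= (y - 1)^-1 by rewrite invr_ge0; lra.
(* As the accumulated product stays below 2, a factor [1 + x] adds at most [2 * x], here at most
   [1444 / y ^ 2] with [1444 = 4 * 19^2]. *)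
have small : 1 + 1500 * ((b - 1)^-1 - (y - 1)^-1) <= 2 by lra.
have cost : 2 / w%:R ^+ 2 <= 722 / y ^+ 2.
  rewrite ler_pdivrMr ?exprn_gt0 // mulrAC ler_pdivlMr; last by rewrite exprn_gt0 //; lra.
  have : y ^+ 2 <= (19 * w%:R) ^+ 2 by rewrite ler_pXn2r ?nnegrE //; lra.
  by rewrite exprMn; lra.
have gap : 1444 / y ^+ 2 <= 1500 * ((y - 1)^-1 - y^-1).
  have -> : (y - 1)^-1 - y^-1 = (y * (y - 1))^-1 by field; apply/andP; split; lra.
  rewrite ler_pdivrMr ?exprn_gt0 //; last by lra.
  have -> : 1500 * (y * (y - 1))^-1 * y ^+ 2 = 1500 * y / (y - 1).
    by field; apply/andP; split; lra.
  by rewrite ler_pdivlMr; nra.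
have w2 : 0 <= 2 / w%:R ^+ 2 :> R by rewrite divr_ge0 ?exprn_ge0 ?ler0n.
set P := 1 + 1500 * ((b - 1)^-1 - (y - 1)^-1) in small *.
have Pw : P * (2 / w%:R ^+ 2) <= 2 * (722 / y ^+ 2).
  by apply: le_trans (ler_wpM2r w2 small) _; rewrite ler_wpM2l.
apply: (@le_trans _ _ (P + 1500 * ((y - 1)^-1 - y^-1))).
  by rewrite [P * _]mulrDr mulr1 lerD2l (le_trans Pw) // mulrA -natrM.
rewrite le_eqVlt; apply/orP; left; apply/eqP; rewrite /P; ring.
Qed.

Lemma pieces (R : archiFieldType) t (eps : R) : 0 < eps ->
  exists m, forall G : sgraph,
    (forall s : seq {set G}, clique_seq s -> (size s < t)%N) ->
    exists s : seq {set G},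
    [/\ forall V, V \in s -> (#|V| <= m)%N,
        forall x y, adj x y -> exists V, [/\ V \in s, x \in V & y \in V] &
        (\sum_(V <- s) #|V|)%:R <= (1 + eps) * #|G|%:R].
Proof.
move=> eps0; have [w0 sep] := separator_log t.
(* The total loss is at most [1500 / (B - 1)], so [B - 1 >= 1500 / eps] suffices. [B] is [19 * n0]
   shifted by the 18 of [pieces_rec]. *)
pose n0 := (Num.bound (1500 / eps) + w0 + 1502)%N.
exists (2 ^ n0)%N => G noK; pose B := (19 * n0 - 18)%N.
have B0 : (1502 <= B)%N by rewrite /B /n0; lia.
have step k w : (0 < w)%N -> (19 * n0 + k <= 19 * w + 18)%N ->
    piece_loss R B k * (1 + 2 / w%:R ^+ 2) <= piece_loss R B k.+1.
  by move=> w_gt0 h; apply: piece_loss_step => //; rewrite /B; lia.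
have g0 : 1 <= piece_loss R B 0 by rewrite /piece_loss addr0 subrr mulr0 addr0.
(* [#|G|] rounds are enough: [(20/19)^n >= n/19] by Bernoulli, and [2 ^ n0 >= 19]. *)
have [|||s [sm sE sS]] := @pieces_rec R w0 n0 _ G (fun U => sep G U noK) _ _ g0 step
    #|G| [set: G].
- by rewrite /n0; lia.
- by rewrite /n0; lia.
- rewrite cardsT; apply: (@leq_trans (20 ^ #|G| * 19)); last first.
    rewrite mulnC leq_mul2r; apply/orP; right.
    by apply: (@leq_trans (2 ^ 5)) => //; rewrite leq_exp2l // /n0; lia.
  apply: leq_trans (bernoulli_nat 19 #|G|).
  by rewrite mulnC leq_mul2l leq_addl orbT.
exists s; split=> //.
- by move=> x y xy; apply: sE; rewrite ?inE.
apply: le_trans sS _; rewrite cardsT ler_wpM2r ?ler0n // lerD2l.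
have Bb : 1500 / eps <= B%:R - 1.
  have : 1500 / eps < (Num.bound (1500 / eps))%:R.
    by apply: archi_boundP; rewrite divr_ge0 // ltW.
  have : (Num.bound (1500 / eps) + 1)%:R <= B%:R :> R by rewrite ler_nat /B /n0; lia.
  by rewrite natrD; lra.
have q0 : 0 < 1500 / eps by rewrite divr_gt0.
have : (B%:R - 1)^-1 <= eps / 1500.
  rewrite -[eps / 1500]invrK lef_pV2 ?posrE ?invr_gt0 ?divr_gt0 //; last by lra.
  by rewrite invf_div.
have : 0 <= (B%:R + #|G|%:R - 1)^-1 :> R.
  by rewrite invr_ge0; have := ler0n R #|G|; lra.
lra.
Qed.

(** Drop items of at most average ratio [e i / v i] one by one: the ratio of the rest never
    decreases, and since an item weighs at most [m], the total weight cannot jump below [n - m] when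
    it first reaches [n]. *)
Lemma knapsack (I : finType) (v e : I -> nat) m n : (m <= n)%N ->
  (forall i, (v i <= m)%N) ->
  forall J0 : {set I}, exists J : {set I},
    [/\ J \subset J0, (\sum_(i in J) v i <= n)%N,
        J = J0 \/ (n - m <= \sum_(i in J) v i)%N &
        ((\sum_(i in J0) e i) * (\sum_(i in J) v i) <=
         (\sum_(i in J) e i) * (\sum_(i in J0) v i))%N].
Proof.
move=> mn vm J0; move: {2}#|J0| (leqnn #|J0|) => N.
elim: N J0 => [|N IH] J0 JN.
  exists J0; split=> //; last by left.
  by move: JN; rewrite leqn0 cards_eq0 => /eqP->; rewrite big_set0.
case: (leqP (\sum_(i in J0) v i) n) => [small|big].
  by exists J0; split=> //; left.
have [i iJ ie] : exists2 i, i \in J0 &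
    (e i * (\sum_(i in J0) v i) <= (\sum_(i in J0) e i) * v i)%N.
  apply/exists_inP; apply: contraTT isT => /exists_inPn h.
  have [j jJ] : exists j, j \in J0.
    apply/set0Pn; apply: contraTneq big => ->; by rewrite big_set0.
  have : ((\sum_(i in J0) e i) * (\sum_(i in J0) v i) <
          (\sum_(i in J0) e i) * (\sum_(i in J0) v i))%N.
    rewrite {2}big_distrl big_distrr /=.
    rewrite (bigD1 j) // [X in (_ < X)%N](bigD1 j) //= -addSn leq_add //.
      by rewrite ltnNge h.
    by apply: leq_sum => k /andP[kJ _]; apply: ltnW; rewrite ltnNge h.
  by rewrite ltnn.
have sv : (\sum_(k in J0) v k = v i + \sum_(k in J0 :\ i) v k)%N by rewrite (big_setD1 i).
have se : (\sum_(k in J0) e k = e i + \sum_(k in J0 :\ i) e k)%N by rewrite (big_setD1 i).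
have [|J [JJ Jn Jm Je]] := IH (J0 :\ i).
  by move: JN; rewrite (cardsD1 i) iJ.
exists J; split.
- exact: subset_trans JJ (subD1set _ _).
- exact: Jn.
- by right; case: Jm => [->|//]; have := vm i; lia.
have v1 : (0 < \sum_(k in J0 :\ i) v k)%N by have := vm i; lia.
rewrite -(leq_pmul2r v1).
move: ie Je; rewrite sv se.
move: (\sum_(k in J0 :\ i) v k)%N (\sum_(k in J0 :\ i) e k)%N v1 (v i) (e i)
  (\sum_(k in J) v k)%N (\sum_(k in J) e k)%N => V1 E1 V1p vi ei V E h1 h2.
have h3 : (ei * V1 <= E1 * vi)%N by lia.
have := leq_mul h2 (leqnn (vi + V1)%N).
have := leq_mul h3 (leqnn V); nia.
Qed.

Lemma set_of_card (T : finType) (A : {set T}) n :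
  (#|A| <= n <= #|T|)%N -> exists2 B : {set T}, A \subset B & #|B| = n.
Proof.
case/andP=> /subnKC <-; move: (n - #|A|)%N => k.
elim: k => [|k IH]; first by rewrite addn0; exists A.
rewrite addnS => kT; have [B AB Bk] := IH (ltnW kT).
have [x _ xB] : exists2 x, x \in [set: T] & x \notin B.
  apply/subsetPn; apply: contraTN kT => /subset_leq_card.
  by rewrite cardsT Bk -leqNgt.
by exists (x |: B); [apply: subset_trans AB (subsetU1 _ _)|rewrite cardsU1 xB Bk].
Qed.

(** The pieces together weigh at most [1 + eps] times [#|G|] and own all edges, so their average
    density is almost that of [G]; [knapsack] selects from them. *)
Lemma dense_sub (R : archiFieldType) t (eps : R) : 0 < eps ->
  exists m, forall (G : sgraph) n,
    (forall s : seq {set G}, clique_seq s -> (size s < t)%N) ->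
    (m <= n <= #|G|)%N -> exists2 U : {set G}, #|U| = n &
      #|edges G|%:R * (n - m)%:R <=
      (1 + eps) * #|G|%:R * #|[set E in edges G | E \subset U]|%:R.
Proof.
move=> eps0; have [m pc] := pieces t eps0; exists m => G n noK /andP[mn nG].
have [s [sm sE sS]] := pc G noK.
pose k := size s; pose V (j : 'I_k) := nth set0 s j.
(* An edge may lie in several pieces; it is charged to the first one, so that the counts add up. *)
pose own (j : 'I_k) := [set E in edges G | find (fun V : {set G} => E \subset V) s == j].
have ownV j E : E \in own j -> E \subset V j.
  rewrite inE => /andP[/mem_edges[x [y [xy ->]]] /eqP ej].
  rewrite /V -ej; apply: (@nth_find _ set0 (fun V : {set G} => [set x; y] \subset V)).
  have [W [Ws xW yW]] := sE _ _ xy.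
  by apply/hasP; exists W => //; apply/subsetP=> z /set2P[]->.
have ownU (J : {set 'I_k}) : (\sum_(j in J) #|own j| =
    #|[set E in edges G | [exists j in J, E \in own j]]|)%N.
  have cardb (A : {set {set G}}) : #|A| = (\sum_E (E \in A))%N.
    by rewrite -sum1_card big_mkcond; apply: eq_bigr => E _; case: (E \in A).
  rewrite cardb; under eq_bigr do rewrite cardb.
  rewrite exchange_big /=; apply: eq_bigr => E _; rewrite [in RHS]inE.
  case: exists_inP => [[j jJ Ej]|h].
    have EG : E \in edges G by move: Ej; rewrite inE => /andP[].
    rewrite EG (bigD1 j) //= Ej big1 // => i /andP[_ ij]; apply/eqP; rewrite eqb0.
    apply: contra ij => Ei; apply/eqP/ord_inj.
    by move: Ej Ei; rewrite !inE => /andP[_ /eqP<-] /andP[_ /eqP<-].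
  rewrite andbF big1 // => j jJ; apply/eqP; rewrite eqb0; apply/negP=> Ej.
  by apply: h; exists j.
have ownT : (\sum_(j in [set: 'I_k]) #|own j| = #|edges G|)%N.
  rewrite ownU; congr (#|pred_of_set _|); apply/setP=> E; rewrite inE.
  case EG: (E \in edges G) => //=; apply/exists_inP.
  have [x [y [xy EE]]] := mem_edges _ EG.
  have [W [Ws xW yW]] := sE _ _ xy.
  have hasE : has (fun V : {set G} => E \subset V) s.
    by apply/hasP; exists W => //; rewrite EE; apply/subsetP=> z /set2P[]->.
  have lt : (find (fun V : {set G} => E \subset V) s < k)%N by rewrite -has_find.
  by exists (Ordinal lt); rewrite ?inE // EG /=.
have sumV : (\sum_(j in [set: 'I_k]) #|V j| = \sum_(W <- s) #|W|)%N.
  by rewrite (big_nth set0) big_mkord; apply: eq_bigl => j; rewrite inE.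
have [j|J [_ Jn Jm Je]] := @knapsack _ (fun j => #|V j|) (fun j => #|own j|) m n mn _ [set: 'I_k].
  by apply: sm; apply: mem_nth.
pose U0 := \bigcup_(j in J) V j.
have U0n : (#|U0| <= n)%N.
  apply: leq_trans Jn; rewrite /U0.
  elim/big_rec2: _ => [|j c A _ IH]; first by rewrite cards0.
  by apply: leq_trans (leq_card_setU _ _) _; rewrite leq_add2l.
have [|U U0U Un] := @set_of_card _ U0 n; first by rewrite U0n.
exists U => //; set e' := #|[set E in edges G | E \subset U]|.
have ee' : (\sum_(j in J) #|own j| <= e')%N.
  rewrite ownU; apply: subset_leq_card; apply/subsetP=> E; rewrite !inE.
  case/andP=> -> /exists_inP[j jJ /ownV EV] /=.
  apply: subset_trans EV _; apply: subset_trans U0U; exact: (bigcup_sup j).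
move: Je; rewrite ownT sumV => Je; move: sS Je.
set v := (\sum_(W <- s) _)%N => sS Je.
case: Jm => [JT|Jm].
  move: ee'; rewrite JT ownT => ee'.
  rewrite [leRHS]mulrC; apply: ler_pM; rewrite ?ler0n ?ler_nat //.
  apply: (@le_trans _ _ #|G|%:R); first by rewrite ler_nat; lia.
  by rewrite ler_peMl ?ler0n // lerDl ltW.
apply: (@le_trans _ _ (v%:R * e'%:R)); last by rewrite ler_wpM2r ?ler0n.
rewrite -!natrM ler_nat mulnC [(v * _)%N]mulnC.
apply: (@leq_trans (#|edges G| * \sum_(i in J) #|V i|)).
  by rewrite mulnC leq_mul2l Jm orbT.
by apply: leq_trans Je _; rewrite leq_mul2r ee' orbT.
Qed.

(** * Convergence of the maximal densities *)

From mathcomp Require Import all_classical all_reals all_analysis.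
Import numFieldNormedType.Exports.

Section Induced.
Variables (G : sgraph) (U : {set G}).

Definition induced_adj (a b : {x : G | x \in U}) : bool := adj (val a) (val b).

Fact induced_sym : symmetric induced_adj.
Proof. by move=> a b; rewrite /induced_adj adj_sym. Qed.

Fact induced_irr : irreflexive induced_adj.
Proof. by move=> a; rewrite /induced_adj adj_irr. Qed.

Definition induced : sgraph := SGraph induced_sym induced_irr.

Lemma subgraph_induced : subgraph induced G.
Proof. by exists val => //; exact: val_inj. Qed.

Lemma card_induced : #|induced| = #|U|.
Proof. by rewrite card_sig; apply: eq_card => x; rewrite inE. Qed.

Lemma edges_induced :
  (#|[set E in edges G | E \subset U]| <= #|edges induced|)%N.
Proof.
apply: leq_trans (leq_imset_card (fun E : {set induced} => [set val z | z in E]) _).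
apply: subset_leq_card; apply/fintype.subsetP=> E.
rewrite inE => /andP[/mem_edges[x [y [xy ->]]] /fintype.subsetP sU].
have xU := sU x (set21 _ _); have yU := sU y (set22 _ _).
pose a : induced := exist _ x xU; pose b : induced := exist _ y yU.
apply/imsetP; exists [set a; b]; last by rewrite imsetU1 imset_set1.
by apply/mem_edges; exists a, b.
Qed.

End Induced.

Lemma density_le_max (R : realType) (H G : sgraph) :
  ~ minor H G -> density R G <= max_density R H #|G|.
Proof.
move=> nm; apply: ub_le_sup; last by exists G.
exists (2 ^ #|G|)%N%:R => _ [G' [<- _ ->]]; rewrite /density.
have eG : (#|edges G'| <= 2 ^ #|G'|)%N.
  rewrite -cardsT -card_powerset; apply: subset_leq_card.
  by apply/fintype.subsetP=> E _; rewrite inE finset.subsetT.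
case: (posnP #|G'|) => [->|G0]; first by rewrite invr0 mulr0.
rewrite ler_pdivrMr ?ltr0n // -natrM ler_nat.
by apply: leq_trans eG _; rewrite leq_pmulr.
Qed.

(** [0 <= b] takes care of the orders without any [H]-minor-free graph, where the supremum is that
    of the empty set, 0. *)
Lemma max_density_le (R : realType) (H : sgraph) n (b : R) : 0 <= b ->
  (forall G : sgraph, #|G| = n -> ~ minor H G -> density R G <= b) ->
  max_density R H n <= b.
Proof.
move=> b0 hb; rewrite /max_density; set A := [set _ | _]%classic.
have [->|/set0P A0] := eqVneq A set0; first by rewrite sup0.
by apply: ge_sup => // _ [G [Gn nm ->]]; apply: hb.
Qed.

Lemma max_density_ge0 (R : realType) (H : sgraph) n : 0 <= max_density R H n.
Proof.
rewrite /max_density; set A := [set _ | _]%classic.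
have [->|/set0P[_ [G [Gn nm _]]]] := eqVneq A set0; first by rewrite sup0.
have := density_le_max R nm; rewrite Gn; apply: le_trans.
by rewrite divr_ge0.
Qed.

Lemma max_density_almost_noninc (R : realType) (H : sgraph) (eta : R) :
  0 < eta -> exists n1, forall N n, (n1 <= n <= N)%N ->
    max_density R H N <= (1 + eta) * max_density R H n.
Proof.
move=> eta0; have eps0 : 0 < eta / 2 by rewrite divr_gt0.
have [m dsub] := dense_sub #|H| eps0.
(* Chosen so that [(1 + eta / 2) * n <= (1 + eta) * (n - m)]. *)
exists (Num.bound (2 * (1 + eta) * m%:R / eta) + m + 1)%N => N n /andP[n1 nN].
apply: max_density_le; first by rewrite mulr_ge0 ?max_density_ge0 //; lra.
move=> G GN nm; have mn : (m < n)%N by lia.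
have [||U Un] := dsub G n.
- move=> s sC; rewrite ltnNge; apply/negP=> Hs; apply: nm.
  exact: clique_seq_minor sC Hs.
- by rewrite (ltnW mn) GN.
set e' := #|[set E in edges G | E \subset U]|%:R => key.
have e'n : e' <= n%:R * max_density R H n.
  have nm' : ~ minor H (induced U).
    by move=> /(minor_sub (subgraph_induced U)).
  have := density_le_max R nm'; rewrite card_induced Un /density card_induced Un.
  rewrite ler_pdivrMr ?ltr0n; last by lia.
  rewrite mulrC; apply: le_trans; rewrite ler_nat; exact: edges_induced.
have [mR nR] : 2 * (1 + eta) * m%:R / eta <= n%:R /\ m%:R + 1 <= n%:R :> R.
  split; last by rewrite natr1 ler_nat; lia.
  apply: (@le_trans _ _ (Num.bound (2 * (1 + eta) * m%:R / eta))%:R).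
    apply: ltW; apply: archi_boundP; rewrite divr_ge0 ?(ltW eta0) //.
    by rewrite mulr_ge0 //; lra.
  by rewrite ler_nat; lia.
move: mR; rewrite ler_pdivrMr // => mR.
rewrite /density; case: (posnP #|G|) => [->|G0].
  by rewrite invr0 mulr0 mulr_ge0 ?max_density_ge0 //; lra.
have G0' : 0 < #|G|%:R :> R by rewrite ltr0n.
rewrite ler_pdivrMr //.
have nm0 : 0 < (n - m)%:R :> R by rewrite ltr0n subn_gt0.
rewrite -(ler_pM2r nm0); apply: le_trans key _.
have -> : (n - m)%:R = n%:R - m%:R :> R by rewrite natrB // ltnW.
have u0 := max_density_ge0 R H n; move: u0 e'n.
move: (max_density R H n) => u u0 e'n.
apply: (@le_trans _ _ ((1 + eta / 2) * #|G|%:R * (n%:R * u))).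
  by rewrite ler_wpM2l // mulr_ge0 //; lra.
have -> : (1 + eta / 2) * #|G|%:R * (n%:R * u) = ((1 + eta / 2) * n%:R) * (#|G|%:R * u).
  by ring.
have -> : (1 + eta) * u * #|G|%:R * (n%:R - m%:R) =
  ((1 + eta) * (n%:R - m%:R)) * (#|G|%:R * u) by ring.
by rewrite ler_wpM2r ?mulr_ge0 //; lra.
Qed.

(** The limit is the lower limit, the supremum of the set [A] of eventual lower bounds. Arbitrarily
    late terms come close to it from above, and the almost monotonicity keeps all later terms
    down. *)
Lemma cvgn_almost_noninc (R : realType) (u : nat -> R) :
  (forall n, 0 <= u n) ->
  (forall eta : R, 0 < eta -> exists n1, forall N n, (n1 <= n <= N)%N ->
    u N <= (1 + eta) * u n) ->
  cvgn u.
Proof.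
move=> u0 um.
pose A := [set x : R | exists n0, forall n, (n0 <= n)%N -> x <= u n]%classic.
have [n1 H1] := um 1 ltr01.
have uB n : (n1 <= n)%N -> u n <= 2 * u n1.
  by move=> nn; have := H1 n n1; rewrite leqnn nn => /(_ isT).
have A0 : A 0 by exists 0%N.
have Aub : has_ubound A.
  exists (2 * u n1) => x [n0 hx].
  by apply: le_trans (hx (maxn n0 n1) _) (uB _ _); rewrite ?leq_maxl ?leq_maxr.
have hsA : has_sup A by split; [exists 0|].
set c := sup A; have c0 : 0 <= c by apply: ub_le_sup.
apply/cvg_ex; exists c; apply/cvgrPdist_le => e e0.
have [x [n0 hx] cx] := sup_adherent e0 hsA.
pose B := 2 * u n1 + 1.
have B1 : 1 <= B by rewrite /B lerDr mulr_ge0.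
have eta0 : 0 < e / 2 / B by rewrite !divr_gt0 //; lra.
have [n2 H2] := um _ eta0.
have [n [nn un]] : exists n, (maxn n1 n2 <= n)%N /\ u n < c + e / 2.
  apply: contrapT => h.
  have : A (c + e / 2).
    exists (maxn n1 n2) => n nn; rewrite leNgt; apply/negP=> un.
    by apply: h; exists n.
  by move/(ub_le_sup Aub); rewrite -/c; lra.
exists (maxn n0 n) => // N /=; rewrite geq_max => /andP[N0 Nn].
rewrite ler_norml; apply/andP; split.
  have := H2 N n; rewrite Nn andbT (leq_trans (leq_maxr _ _) nn) => /(_ isT).
  have un1 : u n <= B.
    by have := uB n (leq_trans (leq_maxl _ _) nn); rewrite /B; lra.
  have : e / 2 / B * u n <= e / 2.
    rewrite -[leRHS](@divfK _ B); last by rewrite gt_eqF //; lra.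
    by rewrite ler_wpM2l // ltW.
  rewrite mulrDl mul1r; move: (e / 2 / B * u n) => z; lra.
by have := hx N N0; move: cx; rewrite -/c; lra.
Qed.

(** The densities [k * e / (s + k * m)] tend to [e / m]. They concern only the orders [s + k * m],
    which determine the limit because it exists. *)
Lemma c_infty_ge (R : realType) (H : sgraph) (s m : nat) (e : R) : (0 < m)%N ->
  (forall k, exists G : sgraph,
     [/\ #|G| = (s + k * m)%N, ~ minor H G & k%:R * e <= #|edges G|%:R]) ->
  e / m%:R <= c_infty R H.
Proof.
move=> m0 hG; set u := max_density R H.
have cu : cvgn u.
  apply: cvgn_almost_noninc; first exact: max_density_ge0.
  exact: max_density_almost_noninc.
have m0' : 0 < m%:R :> R by rewrite ltr0n.
rewrite /c_infty -/u leNgt; apply/negP; rewrite ltr_pdivlMr // => ce.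
(* [(c + d) * m] lies halfway between [c * m] and [e]. *)
set c := limn u in ce *; pose d : R := (e - c * m%:R) / (2 * m%:R).
have d0 : 0 < d by rewrite divr_gt0 ?mulr_gt0 ?subr_gt0.
have /cvgrPdist_lt/(_ d d0)[K _ HK] : (u @ \oo --> c)%classic by exact: cu.
have md : m%:R * d = (e - c * m%:R) / 2 by rewrite /d; field; lra.
have key k : (K <= k)%N -> k%:R * (m%:R * d) <= (c + d) * s%:R.
  move=> Kk; have [G [GN nm Ge]] := hG k.
  have := density_le_max R nm; rewrite GN -/u /density GN.
  have Kn : (K <= s + k * m)%N.
    by apply: leq_trans (leq_addl _ _); apply: leq_trans Kk _; rewrite leq_pmulr.
  have := HK _ Kn; rewrite /= distrC ltr_norml => /andP[_ uc].
  case: (posnP k) => [-> _|k0].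
    rewrite mul0r mulr_ge0 //.
    have : 0 <= u (s + k * m)%N by apply: max_density_ge0.
    by move: uc; lra.
  rewrite ler_pdivrMr ?ltr0n ?addn_gt0 ?muln_gt0 ?k0 ?m0 ?orbT // => h.
  have : k%:R * e <= (c + d) * (s%:R + k%:R * m%:R).
    rewrite -natrM -natrD; apply: le_trans Ge _.
    by apply: le_trans h _; rewrite ler_wpM2r //; lra.
  have -> : e = c * m%:R + 2 * (m%:R * d) by rewrite md; field.
  lra.
have md0 : 0 < m%:R * d by rewrite mulr_gt0.
have := key (K + Num.bound ((c + d) * s%:R / (m%:R * d)))%N (leq_addr _ _).
have cd0 : 0 <= c + d.
  have := HK K (leqnn K); rewrite /= distrC ltr_norml => /andP[_].
  by have := max_density_ge0 R H K; rewrite -/u; lra.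
have := archi_boundP (divr_ge0 (mulr_ge0 cd0 (ler0n R s)) (ltW md0)).
rewrite ltr_pdivrMr // natrD mulrDl => h1 h2.
have : 0 <= K%:R * (m%:R * d) by rewrite mulr_ge0 // ltW.
by move: h1 h2; lra.
Qed.

(** * The random gadget *)

Lemma card_finset (I : finType) : #|{set I}| = (2 ^ #|I|)%N.
Proof.
rewrite -[in RHS]cardsT -card_powerset -cardsT.
by apply: eq_card => A; rewrite !inE finset.subsetT.
Qed.

Lemma card_avoid (R : realFieldType) (I : finType) (P : {set I}) :
  #|[set w : {set I} | w :&: P == finset.set0]|%:R = 2 ^+ #|I| / 2 ^+ #|P| :> R.
Proof.
have -> : [set w : {set I} | w :&: P == finset.set0] = powerset (~: P).
  by apply/setP=> w; rewrite !inE finset.setI_eq0 finset.disjoints_subset.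
rewrite card_powerset natrX -(cardsC P) exprD.
by rewrite mulrAC mulfV ?mul1r // expf_neq0 // pnatr_eq0.
Qed.

(** A set [w] is recovered from [w :\: P], a member of [A] that avoids [P], and from [w :&: P]. *)
Lemma card_avoid_closed (I : finType) (A : {set {set I}}) (P : {set I}) :
  (forall w, w \in A -> w :\: P \in A) ->
  (#|A| <= #|[set w in A | w :&: P == finset.set0]| * 2 ^ #|P|)%N.
Proof.
move=> clA; rewrite -card_powerset -cardsX.
pose split w : {set I} * {set I} := (w :\: P, w :&: P).
have inj : injective split.
  by move=> w w' [e1 e2]; rewrite -(finset.setID w P) e1 e2 finset.setID.
rewrite -(card_imset _ inj); apply: subset_leq_card; apply/fintype.subsetP=> _ /imsetP[w wA ->].
rewrite !inE /= clA //= finset.subsetIr andbT.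
by apply/eqP/setP=> x; rewrite !inE; case: (x \in P); rewrite ?andbF.
Qed.

(** Independence of hitting disjoint sets, in counting form. Hitting the other sets survives the
    removal of [P p], so [card_avoid_closed] applies at each step. *)
Lemma card_hit_all (R : realFieldType) (I : finType) (K : eqType)
    (P : K -> {set I}) (s : seq K) : uniq s ->
  {in s &, forall p q, p != q -> [disjoint P p & P q]} ->
  #|[set w : {set I} | all (fun p => w :&: P p != finset.set0) s]|%:R <=
    2 ^+ #|I| * \prod_(p <- s) (1 - (2 ^+ #|P p|)^-1) :> R.
Proof.
elim: s => [|p s IH] /=.
  move=> _ _; rewrite big_nil mulr1 -natrX ler_nat.
  by rewrite -card_finset max_card.
case/andP=> ps us dis; pose A := [set w : {set I} | all (fun p => w :&: P p != finset.set0) s].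
have dis' q : q \in s -> [disjoint P q & P p].
  move=> qs; apply: dis; rewrite ?inE ?qs ?eqxx ?orbT //.
  by apply: contraNneq ps => <-.
have clA w : w \in A -> w :\: P p \in A.
  rewrite !inE => /allP wA; apply/allP=> q qs.
  have := wA q qs; congr (_ != _); apply/setP=> x; rewrite !inE.
  case xq: (x \in P q); rewrite ?andbF // !andbT.
  by rewrite (disjointFr (dis' q qs) xq).
set A0 := [set w in A | w :&: P p == finset.set0].
have A0A : A0 \subset A by apply/fintype.subsetP=> w; rewrite inE => /andP[].
have -> : [set w : {set I} | (w :&: P p != finset.set0) &&
    all (fun p => w :&: P p != finset.set0) s] = A :\: A0.
  by apply/setP=> w; rewrite !inE; case: (all _ s); rewrite ?andbF ?andbT.
have cA : #|A|%:R / 2 ^+ #|P p| <= #|A0|%:R :> R.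
  rewrite ler_pdivrMr ?exprn_gt0 // -natrX -natrM ler_nat.
  exact: card_avoid_closed.
rewrite cardsD (finset.setIidPr A0A) natrB ?subset_leq_card //.
have q0 : 0 <= 1 - (2 ^+ #|P p|)^-1 :> R.
  by rewrite subr_ge0 invf_le1 ?exprn_gt0 // exprn_ege1 // ler1n.
rewrite big_cons mulrCA mulrC; apply: le_trans (ler_wpM2r q0 (IH us _)).
  by rewrite mulrBr mulr1; lra.
by move=> a b aS bS; apply: dis; rewrite inE ?aS ?bS orbT.
Qed.

Lemma prod_le_expR (R : realType) (K : Type) (s : seq K) (x : K -> R) :
  (forall k, x k <= 1) ->
  \prod_(k <- s) (1 - x k) <= expR (- \sum_(k <- s) x k).
Proof.
move=> x1; elim: s => [|k s IH]; first by rewrite !big_nil oppr0 expR0.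
rewrite !big_cons opprD expRD ler_pM ?subr_ge0 //.
  by apply: prodr_ge0 => i _; rewrite subr_ge0.
exact: expR_ge1Dx.
Qed.

(* Jensen's inequality, through the tangent of the exponential at [- t]. *)
Lemma sum_exp2V_ge (R : realType) (K : Type) (s : seq K) (n : K -> nat) (t : R) :
  ln 2 * (\sum_(k <- s) n k)%:R <= (size s)%:R * t ->
  (size s)%:R * expR (- t) <= \sum_(k <- s) (2 ^+ n k)^-1.
Proof.
have tangent k : expR (- t) * (1 + t - ln 2 * (n k)%:R) <= (2 ^+ n k)^-1.
  have -> : (2 ^+ n k)^-1 = expR (- t) * expR (t - ln 2 * (n k)%:R) :> R.
    rewrite -expRD addrA addNr add0r expRN mulrC expRM_natl lnK //.
    by rewrite posrE ltr0n.
  by rewrite ler_wpM2l ?expR_ge0 // -addrA expR_ge1Dx.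
move=> h; apply: le_trans (_ : _ <= \sum_(k <- s) expR (- t) * (1 + t - ln 2 * (n k)%:R)) _.
  rewrite -big_distrr /= [leLHS]mulrC ler_wpM2l ?expR_ge0 // sumrB.
  rewrite big_const_seq count_predT iter_addr addr0 -big_distrr /= -natr_sum.
  by rewrite -[X in _ <= X - _]mulr_natl mulrDr mulr1; lra.
by apply: ler_sum => k _.
Qed.

Lemma card_hit (R : realFieldType) (I : finType) (P : {set I}) :
  #|[set w : {set I} | w :&: P != finset.set0]|%:R =
    2 ^+ #|I| * (1 - (2 ^+ #|P|)^-1) :> R.
Proof.
have := cardsC [set w : {set I} | w :&: P == finset.set0].
have -> : ~: [set w : {set I} | w :&: P == finset.set0] =
    [set w : {set I} | w :&: P != finset.set0] by apply/setP=> w; rewrite !inE.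
have -> : #|{set I}| = (2 ^ #|I|)%N by rewrite card_finset.
move/(congr1 (fun n => n%:R : R)); rewrite natrD card_avoid natrX => e.
by apply/eqP; rewrite mulrBr mulr1 eq_sym subr_eq addrC e.
Qed.

Section RandomGadget.
Variables m s j : nat.

(* A random set of slots encodes the gadget: a pair of ['I_m] is an edge when
   its slot is present, and [v : 'I_s] is linked to [h : 'I_m] unless their [j]
   slots are all absent. Slots [inl E] with [#|E| <> 2] play no role. *)
Local Notation slot := ({set 'I_m} + 'I_s * 'I_m * 'I_j)%type.

Definition rand_adj (w : {set slot}) (h h' : 'I_m) : bool :=
  (h != h') && (inl [set h; h'] \in w).

Fact rand_sym w : symmetric (rand_adj w).
Proof. by move=> h h'; rewrite /rand_adj eq_sym finset.setUC. Qed.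

Fact rand_irr w : irreflexive (rand_adj w).
Proof. by move=> h; rewrite /rand_adj eqxx. Qed.

Definition rand_graph w : sgraph := SGraph (rand_sym w) (rand_irr w).

Definition rand_link (w : {set slot}) (v : 'I_s) (h : rand_graph w) : bool :=
  [exists i : 'I_j, inr (v, h, i) \in w].

(** Twice the number of edges that one copy of the gadget contributes to the fan. *)
Definition gadget_degree (w : {set slot}) : nat :=
  2 * (\sum_(v < s) \sum_(h : rand_graph w) rand_link v h) +
  \sum_(h : rand_graph w) \sum_(h' : rand_graph w) adj h h'.

Lemma gadget_degree_le w : (gadget_degree w <= 2 * (s * m) + m * m)%N.
Proof.
rewrite /gadget_degree; apply: leq_add.
  rewrite leq_mul2l /=; apply: (@leq_trans (\sum_(v < s) \sum_(h < m) 1)).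
    by apply: leq_sum => v _; apply: leq_sum => h _; apply: leq_b1.
  by rewrite sum_nat_const card_ord sum1_card card_ord.
apply: (@leq_trans (\sum_(v < m) \sum_(h < m) 1)).
  by apply: leq_sum => v _; apply: leq_sum => h _; apply: leq_b1.
by rewrite sum_nat_const card_ord sum1_card card_ord.
Qed.

Lemma sum_bool_card (T : finType) (p : pred T) : (\sum_x p x = #|[set x | p x]|)%N.
Proof. by rewrite -sum1_card [RHS]big_mkcond; apply: eq_bigr => x _; rewrite inE; case: (p x). Qed.

Lemma sum_gadget_degree (R : realFieldType) :
  (\sum_(w : {set slot}) gadget_degree w)%:R =
    2 ^+ #|{: slot}| *
    (2 * s%:R * m%:R * (1 - (2 ^+ j)^-1) + m%:R * (m%:R - 1) / 2) :> R.
Proof.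
rewrite /gadget_degree big_split /= natrD mulrDr; congr (_ + _).
  rewrite -big_distrr /= exchange_big /=.
  rewrite (eq_bigr (fun v : 'I_s => \sum_(h < m) \sum_(w : {set slot})
      [exists i : 'I_j, inr (v, h, i) \in w])%N); last first.
    by move=> v _; rewrite exchange_big.
  rewrite natrM natr_sum (eq_bigr (fun=> m%:R * (2 ^+ #|{: slot}| * (1 - (2 ^+ j)^-1)))).
    rewrite sumr_const card_ord -[_ *+ s]mulr_natl.
    by set N : R := 2 ^+ #|_|; set z : R := _^-1; move: N z => N z; ring.
  move=> v _; rewrite natr_sum.
  rewrite (eq_bigr (fun=> 2 ^+ #|{: slot}| * (1 - (2 ^+ j)^-1))).
    by rewrite sumr_const card_ord -[_ *+ m]mulr_natl.
  move=> h _; rewrite sum_bool_card.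
  pose P : {set slot} := [set inr (v, h, i) | i : 'I_j].
  have cP : #|P| = j by rewrite card_imset ?card_ord // => a b [].
  have := card_hit R P; rewrite cP => <-; congr (#|pred_of_set _|%:R); apply/setP=> w.
  rewrite !inE; apply/existsP/set0Pn => [[i iw]|[x]].
    by exists (inr (v, h, i)); rewrite inE iw; apply: imset_f.
  by rewrite inE => /andP[xw /imsetP[i _ e]]; exists i; rewrite -e.
rewrite exchange_big /=.
rewrite (eq_bigr (fun h : 'I_m => \sum_(h' < m) \sum_(w : {set slot})
    rand_adj w h h')%N); last by move=> h _; rewrite exchange_big.
rewrite natr_sum (eq_bigr (fun=> (m%:R - 1) * (2 ^+ #|{: slot}| / 2))).
  by rewrite sumr_const card_ord -[_ *+ m]mulr_natl; set N : R := 2 ^+ #|_|; move: N => N; field.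
move=> h _; rewrite (bigD1 h) //= [X in (X + _)%N]big1 ?add0n; last first.
  by move=> w _; rewrite /rand_adj eqxx.
rewrite natr_sum (eq_bigr (fun=> 2 ^+ #|{: slot}| / 2)).
  rewrite sumr_const -[LHS]mulr_natl; congr (_ * _).
  have := cardC1 h; rewrite card_ord => ->.
  by case: (m) h => [[]|m' _] //=; rewrite -natr1 addrK.
move=> h' hh'; rewrite sum_bool_card.
pose P : {set slot} := [set inl [set h; h']].
have half : 2^-1 = 1 - (2 ^+ #|P|)^-1 :> R by rewrite cards1 expr1; field.
have := card_hit R P; rewrite -half => <-; congr (#|pred_of_set _|%:R); apply/setP=> w.
rewrite !inE /rand_adj eq_sym hh' /=; apply/idP/set0Pn => [wP|[x]].
  by exists (inl [set h; h']); rewrite inE wP set11.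
by rewrite inE => /andP[xw /set1P e]; rewrite -e.
Qed.

Section Structures.
Variable r : nat.
Implicit Types (f : {ffun 'I_m -> option 'I_r}) (g : {ffun 'I_s -> option 'I_r}).

(** The slots able to join branch set [p.1], which avoids S, to [p.2], which may use S; hence [g] is
    consulted for [p.2] only. *)
Definition slots_between f g (p : 'I_r * 'I_r) : {set slot} :=
  [set inl [set x.1; x.2]
    | x in finset.setX [set h | f h == Some p.1] [set h | f h == Some p.2]] :|:
  [set inr x
    | x in finset.setX (finset.setX [set v | g v == Some p.2] [set h | f h == Some p.1])
                [set: 'I_j]].

Lemma card_slots_between f g p :
  (#|slots_between f g p| <=
   #|[set h | f h == Some p.1]| * #|[set h | f h == Some p.2]| +
   j * (#|[set h | f h == Some p.1]| * #|[set v | g v == Some p.2]|))%N.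
Proof.
apply: leq_trans (leq_card_setU _ _) _; apply: leq_add.
  by apply: leq_trans (leq_imset_card _ _) _; rewrite cardsX.
apply: leq_trans (leq_imset_card _ _) _; rewrite !cardsX cardsT card_ord; lia.
Qed.

(** A slot inside the gadget determines its two branch sets only as an unordered pair; one index
    being in [Y] and the other outside fixes the order. *)
Lemma slots_between_disjoint f g (Y : {set 'I_r}) :
  {in finset.setX Y (~: Y) &, forall p p', p != p' ->
    [disjoint slots_between f g p & slots_between f g p']}.
Proof.
move=> [a b] [a' b']; rewrite !finset.in_setX !finset.in_setC /= => /andP[aY bY] /andP[aY' bY'].
apply: contraNT; rewrite -finset.setI_eq0 => /set0Pn[x]; rewrite 3!inE.
case/andP=> /orP[] /imsetP[y]; rewrite !inE /=.
- move=> /andP[/eqP f1 /eqP f2] -> /orP[] /imsetP[z]; rewrite !inE /=; last by [].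
  move=> /andP[/eqP f3 /eqP f4] [e].
  have : y.1 \in [set z.1; z.2] by rewrite -e set21.
  have : y.2 \in [set z.1; z.2] by rewrite -e set22.
  rewrite !inE; move=> /orP[]/eqP e2 /orP[]/eqP e1; move: f1 f2.
  + by rewrite e2 f3 => _ [ab]; rewrite -ab aY' in bY.
  + by rewrite e2 f3 => _ [ab]; rewrite -ab aY' in bY.
  + by rewrite e1 f3 e2 f4 => -[->] [->]; rewrite eqxx.
  + by rewrite e1 f4 => -[ab]; rewrite ab aY in bY'.
- move=> /andP[/andP[/eqP g1 /eqP f1] _] -> /orP[] /imsetP[z]; rewrite !inE /=; first by [].
  move=> /andP[/andP[/eqP g2 /eqP f2] _] [e]; move: g1 f1.
  by rewrite e g2 f2 => -[->] [->]; rewrite eqxx.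
Qed.

Lemma sum_fibers (n : nat) (h : {ffun 'I_n -> option 'I_r}) :
  (\sum_(a < r) #|[set x | h x == Some a]| = #|[set x | h x != None]|)%N.
Proof.
rewrite -(sum_bool_card (fun x => h x != None)).
rewrite (eq_bigr (fun a : 'I_r => \sum_x (h x == Some a))%N); last first.
  by move=> a _; rewrite -sum_bool_card.
rewrite exchange_big /=; apply: eq_bigr => x _; case: (h x) => [a|] /=.
  rewrite (bigD1 a) //= eqxx big1 // => b /negPf ba.
  by rewrite (inj_eq Some_inj) eq_sym ba.
by rewrite big1.
Qed.

(** If [x] gadget vertices serve [Y] and [y] serve its complement, then [4xy <= (x + y)^2 <= m^2]: a
    bound uniform in the structure. *)
Lemma sum_slots_between f g (Y : {set 'I_r}) n : (#|[set v | g v != None]| <= n)%N ->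
  (4 * (\sum_(p <- enum (finset.setX Y (~: Y))) #|slots_between f g p|) <=
   m ^ 2 + 4 * (j * m * n))%N.
Proof.
move=> gn; rewrite big_enum /=.
pose F a := #|[set h | f h == Some a]|; pose Gn b := #|[set v | g v == Some b]|.
have le1 : (\sum_(p in finset.setX Y (~: Y)) #|slots_between f g p| <=
   (\sum_(a in Y) F a) * (\sum_(b in ~: Y) F b) +
   j * ((\sum_(a in Y) F a) * (\sum_(b in ~: Y) Gn b)))%N.
  apply: (@leq_trans (\sum_(p in finset.setX Y (~: Y))
      (F p.1 * F p.2 + j * (F p.1 * Gn p.2)))%N).
    by apply: leq_sum => p _; apply: card_slots_between.
  rewrite big_split /= -big_distrr /=.
  have dist (u v : 'I_r -> nat) : (\sum_(p in finset.setX Y (~: Y)) u p.1 * v p.2 =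
      (\sum_(a in Y) u a) * (\sum_(b in ~: Y) v b))%N.
    rewrite big_distrlr /= pair_big /=; apply: eq_bigl => -[a b].
    by rewrite finset.in_setX.
  by rewrite !dist.
have FF : (\sum_(a in Y) F a + \sum_(b in ~: Y) F b <= m)%N.
  have -> : (\sum_(a in Y) F a + \sum_(b in ~: Y) F b = \sum_a F a)%N.
    by rewrite [RHS](bigID (mem Y)) /=; congr (_ + _)%N; apply: eq_bigl => a; rewrite !inE.
  by rewrite sum_fibers; apply: leq_trans (max_card _) _; rewrite card_ord.
have GG : (\sum_(b in ~: Y) Gn b <= n)%N.
  apply: leq_trans gn; rewrite -sum_fibers [leqRHS](bigID (mem Y)) /=.
  rewrite addnC -[leqLHS]addn0; apply: leq_add => //.
  by apply: eq_leq; apply: eq_bigl => a; rewrite !inE.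
apply: leq_trans (leq_mul (leqnn 4) le1) _.
move: FF GG; move: (\sum_(a in Y) F a)%N (\sum_(b in ~: Y) F b)%N (\sum_(b in ~: Y) Gn b)%N.
move=> x y z xy zn; rewrite mulnDr; apply: leq_add.
  by apply: leq_trans (nat_AGM2 x y) _; rewrite leq_exp2r.
by rewrite leq_mul2l /= -mulnA leq_mul2l leq_mul ?orbT //; lia.
Qed.

End Structures.

(** [t] bounds [ln 2] times the mean number of slots over the [q * (r - q)] pairs. By convexity an
    even distribution of the slots is the worst case. *)
Lemma card_bad_structure (R : realType) r q (t : R)
    (f : {ffun 'I_m -> option 'I_r}) (g : {ffun 'I_s -> option 'I_r}) (Y : {set 'I_r}) :
  (q <= r)%N -> #|Y| = q -> (#|[set v | g v != None]| <= r - q)%N ->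
  ln 2 * ((m ^ 2)%:R / 4 + j%:R * m%:R * (r - q)%:R) <= (q * (r - q))%:R * t ->
  #|[set w : {set slot} | all (fun p => w :&: slots_between f g p != finset.set0)
       (enum (finset.setX Y (~: Y)))]|%:R <=
    2 ^+ #|{: slot}| * expR (- ((q * (r - q))%:R * expR (- t))).
Proof.
move=> qr Yq gn ht.
apply: le_trans (card_hit_all _ (enum_uniq _) _) _.
  by move=> p p'; rewrite !mem_enum; apply: slots_between_disjoint.
rewrite ler_wpM2l ?exprn_ge0 //.
apply: le_trans (prod_le_expR _ _) _.
  by move=> p; rewrite invf_le1 ?exprn_gt0 // exprn_ege1 // ler1n.
have sz : size (enum (finset.setX Y (~: Y))) = (q * (r - q))%N.
  have cY : #|~: Y| = (r - q)%N by have := cardsC Y; rewrite card_ord Yq; lia.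
  by rewrite -cardE cardsX Yq cY.
rewrite ler_expR lerN2 -sz; apply: sum_exp2V_ge; rewrite sz.
apply: le_trans ht; rewrite ler_wpM2l ?ln_ge0 ?ler1n //.
have := sum_slots_between f Y gn; rewrite -(ler_nat R) natrM natrD !natrM; lra.
Qed.

(** The share of bad slot sets is at most one over the largest possible degree [M], so they
    contribute at most 1 to the mean degree [mu]. If all good ones had degree below [mu - 2], the
    mean would be at most [mu - 1]. *)
Lemma random_gadget (R : realType) l r q (t : R) :
  (0 < l)%N -> (0 < q)%N -> (q <= r)%N -> (s <= l * (r - q))%N -> (3 <= m)%N ->
  ln 2 * ((m ^ 2)%:R / 4 + j%:R * m%:R * (r - q)%:R) <= (q * (r - q))%:R * t ->
  (r.+1 ^ m * r.+1 ^ s * 2 ^ r * (2 * (s * m) + m * m))%:R *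
    expR (- ((q * (r - q))%:R * expR (- t))) <= 1 ->
  exists w : {set slot},
    (forall k, ~ minor (copies l (complete_graph r)) (fan (@rand_link w) k)) /\
    2 * s%:R * m%:R * (1 - (2 ^+ j)^-1) + m%:R * (m%:R - 1) / 2 - 2 <=
      (gadget_degree w)%:R :> R.
Proof.
move=> l0 q0 qr sl m3 ht hu.
pose St := ({ffun 'I_m -> option 'I_r} * {ffun 'I_s -> option 'I_r} * {set 'I_r})%type.
pose valid (x : St) := (#|x.2| == q) && (#|[set v | x.1.2 v != None]| <= r - q)%N.
pose hits (x : St) := [set w : {set slot} |
  all (fun p => w :&: slots_between x.1.1 x.1.2 p != finset.set0)
      (enum (finset.setX x.2 (~: x.2)))].
pose bad := \bigcup_(x | valid x) hits x.
have good w : w \notin bad ->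
    forall k, ~ minor (copies l (complete_graph r)) (fan (@rand_link w) k).
  move=> wb k /(fan_model l0 q0 qr); rewrite card_ord => /(_ sl).
  case=> f [g [Y [Yq gn _ FG]]]; case/negP: wb.
  apply/bigcupP; exists (f, g, Y); first by rewrite /valid /= Yq eqxx gn.
  rewrite inE; apply/allP=> -[a b]; rewrite mem_enum finset.in_setX finset.in_setC /= => /andP[aY bY].
  case: (FG a b aY bY) => [[h [h' [fh fh' /andP[_ hh']]]]|[h [v [fh gv /existsP[i vh]]]]].
    apply/set0Pn; exists (inl [set h; h']); rewrite !inE hh' /=; apply/orP; left.
    by apply/imsetP; exists (h, h'); rewrite // !inE /= fh fh' !eqxx.
  apply/set0Pn; exists (inr (v, h, i)); rewrite !inE vh /=; apply/orP; right.
  by apply/imsetP; exists (v, h, i); rewrite // !inE /= fh gv !eqxx.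
set N : R := 2 ^+ #|{: slot}|.
set M := (2 * (s * m) + m * m)%N in hu.
set x := expR _ in hu.
have cSt : #|{: St}| = (r.+1 ^ m * r.+1 ^ s * 2 ^ r)%N.
  rewrite !card_prod !card_ffun !card_option !card_ord.
  by rewrite card_finset card_ord.
have badN : #|bad|%:R * M%:R <= N.
  apply: (@le_trans _ _ ((#|{: St}|%:R * (N * x)) * M%:R)).
    rewrite ler_wpM2r //; apply: (@le_trans _ _ (\sum_(y | valid y) #|hits y|)%:R).
      rewrite ler_nat /bad; elim/big_rec2: _ => [|y c A _ IH]; first by rewrite cards0.
      by apply: leq_trans (leq_card_setU _ _) _; rewrite leq_add2l.
    rewrite natr_sum; apply: (@le_trans _ _ (\sum_(y : St | valid y) N * x)).
      by apply: ler_sum => -[[f g] Y] /andP[/eqP Yq gn]; apply: card_bad_structure.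
    rewrite sumr_const -[leLHS]mulr_natl ler_wpM2r ?ler_nat ?max_card //.
    by rewrite mulr_ge0 ?expR_ge0 // exprn_ge0.
  rewrite cSt; have N0 : 0 <= N by rewrite exprn_ge0.
  move: hu; rewrite natrM; set A := (_ ^ _ * _ * _)%:R => hu.
  have -> : A * (N * x) * M%:R = N * (A * M%:R * x) by ring.
  by rewrite ler_piMr.
set mu := 2 * s%:R * m%:R * _ + _.
have N0 : 0 < N by rewrite exprn_gt0.
have mu3 : 3 <= mu.
  rewrite /mu; have m3' : 3 <= m%:R :> R by rewrite ler_nat.
  have : 0 <= 2 * s%:R * m%:R * (1 - (2 ^+ j)^-1) :> R.
    by rewrite mulr_ge0 // subr_ge0 invf_le1 ?exprn_gt0 // exprn_ege1 // ler1n.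
  by move: (2 * s%:R * m%:R * (1 - (2 ^+ j)^-1) : R) => z; nra.
have [w wb wd] : exists2 w, w \notin bad & mu - 2 <= (gadget_degree w)%:R.
  apply: contrapT => h.
  have : (\sum_(w : {set slot}) gadget_degree w)%:R <= N + N * (mu - 2).
    rewrite natr_sum (bigID (mem bad)) /= lerD //.
      apply: le_trans badN; rewrite mulr_natl -sumr_const.
      by apply: ler_sum => w _; rewrite ler_nat gadget_degree_le.
    apply: (@le_trans _ _ (\sum_(w : {set slot} | w \notin bad) (mu - 2))).
      apply: ler_sum => w wb; rewrite leNgt; apply/negP=> wd.
      by apply: h; exists w => //; apply: ltW.
    rewrite sumr_const -[leLHS]mulr_natl ler_wpM2r //; first by lra.
    apply: (@le_trans _ _ #|{: {set slot}}|%:R); first by rewrite ler_nat max_card.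
    by rewrite card_finset natrX.
  rewrite sum_gadget_degree -/N -/mu; move: N0 mu3; clear; move: N mu => N mu; nra.
by exists w; split=> //; apply: good.
Qed.

End RandomGadget.

Lemma c_infty_gadget (R : realType) m s j l r q (t : R) :
  (0 < l)%N -> (0 < q)%N -> (q <= r)%N -> (s <= l * (r - q))%N -> (3 <= m)%N ->
  ln 2 * ((m ^ 2)%:R / 4 + j%:R * m%:R * (r - q)%:R) <= (q * (r - q))%:R * t ->
  (r.+1 ^ m * r.+1 ^ s * 2 ^ r * (2 * (s * m) + m * m))%:R *
    expR (- ((q * (r - q))%:R * expR (- t))) <= 1 ->
  s%:R * (1 - (2 ^+ j)^-1) + m%:R / 4 - 1 <=
    c_infty R (copies l (complete_graph r)).
Proof.
move=> l0 q0 qr sl m3 ht hu.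
have [w [nm deg]] := random_gadget l0 q0 qr sl m3 ht hu.
have m0 : (0 < m)%N by lia.
have m3' : 3 <= m%:R :> R by rewrite ler_nat.
apply: le_trans (_ : _ <= (gadget_degree w)%:R / 2 / m%:R) _.
  (* The final [- 1] absorbs [1/4], from [m - 1] in place of [m], and [1/m]. *)
  rewrite ler_pdivlMr; last by lra.
  apply: le_trans (_ : _ <= (2 * s%:R * m%:R * (1 - (2 ^+ j)^-1) +
    m%:R * (m%:R - 1) / 2 - 2) / 2) _; last by lra.
  move: (1 - (2 ^+ j)^-1) => z; nra.
apply: (@c_infty_ge R _ s m _ m0) => k; exists (fan (@rand_link m s j w) k); split.
- by rewrite card_fan !card_ord.
- exact: nm.
- have := fan_edges (@rand_link m s j w) k; rewrite -/(gadget_degree w).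
  by rewrite -(ler_nat R) !natrM; lra.
Qed.

(** * Choice of the parameters *)

(** Two branch sets avoiding S would have to share the single vertex of one copy. *)
Lemma c_infty_star (R : realType) (l r : nat) : (0 < l)%N -> (2 <= r)%N ->
  l%:R * (r%:R - 2) <= c_infty R (copies l (complete_graph r)).
Proof.
move=> l0 r2; pose s := (l * (r - 2))%N; pose H := complete_graph 1.
have -> : l%:R * (r%:R - 2) = s%:R / 1%:R :> R by rewrite divr1 natrM natrB.
apply: (@c_infty_ge R _ s 1) => // k.
pose aS (v : 'I_s) (h : H) := true.
exists (fan aS k); split.
- by rewrite card_fan !card_ord muln1.
- move/(fan_model l0 (isT : (0 < 2)%N) r2); rewrite card_ord => /(_ (leqnn _)).
  case=> f [g [Y [Y2 _ Yf _]]].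
  have /cards2P[a [b [ab YE]]] : #|Y| == 2%N by rewrite Y2.
  have [h fa] := Yf a (eq_ind_r (fun Z : {set _} => a \in Z) (set21 _ _) YE).
  have [h' fb] := Yf b (eq_ind_r (fun Z : {set _} => b \in Z) (set22 _ _) YE).
  by move: ab; rewrite (ord1 h) in fa; rewrite (ord1 h') fa in fb; case: fb => ->; rewrite eqxx.
- have := fan_edges aS k; have -> : (\sum_(v < s) \sum_(h : H) aS v h = s)%N.
    rewrite (eq_bigr (fun=> 1%N)) ?sum1_card ?card_ord // => v _.
    by rewrite sum1_card card_ord.
  have -> : (\sum_(h : H) \sum_(h' : H) adj h h' = 0)%N.
    by rewrite big1 // => h _; rewrite big1 // => h' _; rewrite (ord1 h) (ord1 h') adj_irr.
  by rewrite -natrM ler_nat; lia.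
Qed.

Lemma lambda_bounds (R : realType) : 0 <= lambda R <= 1 / 2.
Proof.
rewrite /lambda; set A := [set _ | _ in _]%classic.
have ubA : ubound A (1 / 2).
  move=> _ [a /= a0 <-].
  have sa0 : 0 < Num.sqrt a by rewrite sqrtr_gt0.
  have aE : a = Num.sqrt a ^+ 2 by rewrite sqr_sqrtr // ltW.
  rewrite ler_pdivrMr ?mulr_gt0 //.
  have -> : 1 / 2 * (2 * Num.sqrt a) = Num.sqrt a by field.
  (* This settles [sqrt a <= 1], where [a <= sqrt a]; beyond 1 the trivial bound [1 - exp(-a) < 1]
     suffices. *)
  have : 1 - expR (- a) <= Num.sqrt a ^+ 2 by rewrite -aE; have := expR_ge1Dx (- a); lra.
  have := expR_gt0 (- a); move: (expR (- a)) (Num.sqrt a) sa0 => e x x0 e0 ex.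
  by have [x1|x1] := lerP x 1; [nra|lra].
have A0 : (A !=set0)%classic by exists ((1 - expR (- 1)) / (2 * Num.sqrt 1)); exists 1 => //=.
apply/andP; split; last exact: ge_sup.
apply: le_trans (_ : (1 - expR (- 1)) / (2 * Num.sqrt 1) <= _).
  rewrite divr_ge0 ?mulr_ge0 ?sqrtr_ge0 // subr_ge0 -expR0 ler_expR; lra.
by apply: ub_le_sup; [exists (1 / 2)|exists 1 => //=].
Qed.

Lemma ln2_bounds (R : realType) : (1 / 2 : R) <= ln 2 <= (72 / 100 : R).
Proof.
have e2 : expR (ln 2) = 2 :> R by rewrite lnK ?posrE.
apply/andP; split; rewrite -ler_expR e2.
  have := expR_ge1Dx (- (1 / 2) : R); rewrite expRN.
  have e0 := expR_gt0 (1 / 2 : R) => h.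
  have : (expR (1 / 2))^-1 * expR (1 / 2) = 1 :> R by rewrite mulVf // gt_eqF.
  by move: e0 h; move: (expR (1 / 2)) => x; move: (x^-1) => y; nra.
(* [exp(0.72) = exp(0.06)^12 >= 1.06^12 > 2]. *)
have h := expR_ge1Dx (6 / 100 : R).
have -> : 72 / 100 = (6 / 100) * 12%:R :> R by lra.
rewrite mulrC expRM_natl; apply: le_trans (_ : (1 + 6 / 100) ^+ 12 <= _); first by lra.
by rewrite lerXn2r ?nnegrE ?expR_ge0 //; lra.
Qed.

(** Five factors [exp(L/50) >= L/50] beat the cube with [L^2] to spare, which absorbs
    [360 * 50^5]. *)
Lemma expR_beats_cube (R : realType) (L : R) :
  360 * 50 ^+ 5 <= L -> 360 * L ^+ 3 <= expR (L / 10).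
Proof.
move=> hL; have h50 : 1 <= 360 * 50 ^+ 5 :> R.
  by rewrite mulr_ege1 ?exprn_ege1 //; lra.
have L1 : 1 <= L by lra.
have -> : L / 10 = 5%:R * (L / 50) by field.
rewrite expRM_natl; apply: (@le_trans _ _ ((L / 50) ^+ 5)); last first.
  have := expR_ge1Dx (L / 50) => h.
  by rewrite lerXn2r ?nnegrE ?expR_ge0 //; lra.
rewrite expr_div_n ler_pdivlMr ?exprn_gt0 //.
have -> : 360 * L ^+ 3 * 50 ^+ 5 = L ^+ 3 * (360 * 50 ^+ 5) by rewrite mulrAC mulrC.
have -> : L ^+ 5 = L ^+ 3 * (L * L) by ring.
rewrite ler_wpM2l ?exprn_ge0 //; first by lra.
by apply: le_trans hL _; rewrite ler_peMr //; lra.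
Qed.

(* With [M = rL/2l], [Q = rL/18l^2] and [J = L/100l], where [L = log r], the
   gadget has [m ~ M], [q ~ Q] and [j ~ J]; up to lower order terms it
   yields [m/4 - lq = (1/8 - 1/18) rL/l], more than the required [rL/16l]. *)
Record gadget_params (R : realType) (l r m q j : nat) (lR rR L M Q J : R) :
    Prop := GadgetParams {
  gp_lN : lR = l%:R;
  gp_rN : rR = r%:R;
  gp_rE : rR = expR L;
  gp_cube : 360 * L ^+ 3 <= expR (L / 10);
  gp_L600 : 600 <= L;
  gp_l1 : 1 <= lR;
  gp_l2 : 4 * L <= lR ^+ 2;
  gp_lL : 100 * lR <= L;
  gp_ME : M * (2 * lR) = rR * L;
  gp_QE : Q * (18 * lR ^+ 2) = rR * L;
  gp_JE : J * (100 * lR) = L;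
  gp_mM : M - 1 < m%:R <= M;
  gp_qQ : Q < q%:R <= Q + 1;
  gp_jJ : J <= 2 * j%:R <= 2 * J }.

Lemma params_L_lt_r (R : realType) l r m q j (lR rR L M Q J : R) :
  gadget_params l r m q j lR rR L M Q J -> 1 + L <= rR.
Proof.
move=> gp; have [lN rN rE _ L600 l1 l2 lL ME QE JE mM qQ jJ] := gp.
by rewrite rE expR_ge1Dx.
Qed.

Lemma params_2L_le_r (R : realType) l r m q j (lR rR L M Q J : R) :
  gadget_params l r m q j lR rR L M Q J -> 2 * L <= rR.
Proof.
move=> gp; have [lN rN rE _ L600 l1 l2 lL ME QE JE mM qQ jJ] := gp.
have [x Lx] : exists x, L = x + x by exists (L / 2); field.
have x0 : 0 <= x by lra.
rewrite rE Lx expRD; have := expR_ge1Dx x; move: (expR x) => e h.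
have := ler_pM (_ : 0 <= 1 + x) (_ : 0 <= 1 + x) h h.
have := sqr_ge0 (1 - x); rewrite expr2 => h1 h2.
by apply: le_trans (h2 _ _); [clear - h1; lra|lra|lra].
Qed.

Lemma params_Q_ge0 (R : realType) l r m q j (lR rR L M Q J : R) :
  gadget_params l r m q j lR rR L M Q J -> 0 <= Q.
Proof.
move=> gp; have [lN rN rE _ L600 l1 l2 lL ME QE JE mM qQ jJ] := gp.
have rL := params_L_lt_r gp.
have l0 : 0 < 18 * lR ^+ 2 by rewrite mulr_gt0 // exprn_gt0 //; lra.
by rewrite -(pmulr_lge0 Q l0) QE mulr_ge0 //; lra.
Qed.

Lemma params_q_small (R : realType) l r m q j (lR rR L M Q J : R) :
  gadget_params l r m q j lR rR L M Q J -> 64 * q%:R <= rR.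
Proof.
move=> gp; have [lN rN rE _ L600 l1 l2 lL ME QE JE mM qQ jJ] := gp.
have Q72 : 72 * Q <= rR.
  have L0 : 0 < L by lra.
  rewrite -(ler_pM2r L0) -QE.
  have -> : 72 * Q * L = 18 * (Q * (4 * L)) by ring.
  have -> : Q * (18 * lR ^+ 2) = 18 * (Q * lR ^+ 2) by ring.
  by rewrite ler_wpM2l // ler_wpM2l // (params_Q_ge0 gp).
(* The gap between 72 and 64 pays for rounding [q] up, as [r >= 576]. *)
by have rL := params_L_lt_r gp; case/andP: qQ => _; lra.
Qed.

Lemma params_q_le_r (R : realType) l r m q j (lR rR L M Q J : R) :
  gadget_params l r m q j lR rR L M Q J -> (q <= r)%N.
Proof.
move=> gp; have [lN rN rE _ L600 l1 l2 lL ME QE JE mM qQ jJ] := gp.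
by rewrite -(ler_nat R); have := ler0n R q; have := params_q_small gp; rewrite -rN; lra.
Qed.

Lemma params_rsubq (R : realType) l r m q j (lR rR L M Q J : R) :
  gadget_params l r m q j lR rR L M Q J -> (r - q)%:R = rR - q%:R.
Proof.
move=> gp; have [lN rN rE _ L600 l1 l2 lL ME QE JE mM qQ jJ] := gp.
by rewrite natrB ?(params_q_le_r gp) // rN.
Qed.

(** As [M^2 = 9/2 Q r L] and [r <= 64/63 (r - q)], the first term is at most [9/8 * 64/63 = 8/7]
    times [q (r - q) L], the second [9/100] of it, and [0.72 * (8/7 + 9/100) < 9/10]. *)
Lemma connection_exponent (R : realType) l r m q j (lR rR L M Q J : R) :
  gadget_params l r m q j lR rR L M Q J ->
  ln 2 * ((m ^ 2)%:R / 4 + j%:R * m%:R * (r - q)%:R) <=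
    (q * (r - q))%:R * (9 / 10 * L).
Proof.
move=> gp; have [lN rN rE _ L600 l1 l2 lL ME QE JE mM qQ jJ] := gp.
rewrite natrM natrX (params_rsubq gp).
have [/andP[mM1 mM2] /andP[qQ1 qQ2] /andP[jJ1 jJ2]] := And3 mM qQ jJ.
have qs := params_q_small gp.
have rL := params_L_lt_r gp.
have rqE := params_rsubq gp.
have l0 : 0 < lR by lra.
have r0 : 0 < rR by lra.
have L0 : 0 < L by lra.
have [r0' L0'] := (ltW r0, ltW L0).
have Q0 := params_Q_ge0 gp.
have M2 : M ^+ 2 = 9 / 2 * Q * rR * L.
  apply: (mulIf (_ : (2 * lR) ^+ 2 != 0)); first by rewrite expf_neq0 // mulf_neq0 // gt_eqF //; lra.
  rewrite -exprMn ME; have -> : 9 / 2 * Q * rR * L * (2 * lR) ^+ 2 = (Q * (18 * lR ^+ 2)) * (rR * L) by field.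
  by rewrite QE expr2.
have JM : J * M = 9 / 100 * Q * L.
  apply: (mulIf (_ : (2 * lR) * (100 * lR) != 0)).
    by rewrite !mulf_neq0 // gt_eqF //; lra.
  have -> : J * M * (2 * lR * (100 * lR)) = (M * (2 * lR)) * (J * (100 * lR)) by ring.
  have -> : 9 / 100 * Q * L * (2 * lR * (100 * lR)) = (Q * (18 * lR ^+ 2)) * L by field.
  by rewrite ME JE QE.
have m0 := ler0n R m; have j0 := ler0n R j; have q0 := ler0n R q.
have M0 : 0 <= M := le_trans m0 mM2.
have rq0 : 0 <= rR - q%:R by clear - qs q0; lra.
have jJ3 : j%:R <= J by clear - jJ2; lra.
have m2 : m%:R ^+ 2 / 4 <= 8 / 7 * (q%:R * (rR - q%:R) * L).
  have : m%:R ^+ 2 <= M ^+ 2 by rewrite lerXn2r ?nnegrE.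
  have : Q * (rR * L) <= q%:R * (64 / 63 * (rR - q%:R) * L).
    apply: ler_pM => //; [exact: mulr_ge0|exact: ltW|].
    by rewrite ler_wpM2r //; clear - qs q0; lra.
  have -> : q%:R * (64 / 63 * (rR - q%:R) * L) = 64 / 63 * (q%:R * (rR - q%:R) * L) by ring.
  have -> : M ^+ 2 = 9 / 2 * (Q * (rR * L)) by rewrite M2; ring.
  move: (q%:R * (rR - q%:R) * L) (Q * (rR * L)) (m%:R ^+ 2 : R) => X Y Z; clear; lra.
have jm : j%:R * m%:R * (rR - q%:R) <= 9 / 100 * (q%:R * (rR - q%:R) * L).
  have h : j%:R * m%:R <= 9 / 100 * q%:R * L.
    apply: (@le_trans _ _ (J * M)); first exact: ler_pM.
    by rewrite JM ler_wpM2r // ler_wpM2l // ltW.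
  have -> : 9 / 100 * (q%:R * (rR - q%:R) * L) = (9 / 100 * q%:R * L) * (rR - q%:R) by ring.
  by rewrite ler_wpM2r.
have X0 : 0 <= q%:R * (rR - q%:R) * L by rewrite !mulr_ge0.
have -> : q%:R * (rR - q%:R) * (9 / 10 * L) = 9 / 10 * (q%:R * (rR - q%:R) * L) by ring.
have /andP[ln1 ln2] := ln2_bounds R.
move: (q%:R * (rR - q%:R) * L) X0 m2 jm => X X0 m2 jm.
apply: (@le_trans _ _ (72 / 100 * (8 / 7 * X + 9 / 100 * X))).
  apply: ler_pM => //; [by apply: le_trans ln1|by rewrite addr_ge0 ?divr_ge0 ?exprn_ge0 ?mulr_ge0|].
  exact: lerD.
by clear - X0; lra.
Qed.

(** The first factor has logarithm at most [10 r L^2], with [2 + 2 + 1 + 5] from [f], [g], [Y] and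
    the degree bound. Against it stands [q (r - q) r^(-9/10) >= r e^(L/10) / (36 L)], from
    [q >= r/(18 L)] and [r - q >= r/2]; hence [360 = 10 * 36] in [gp_cube]. *)
Lemma union_bound (R : realType) l r m q j (lR rR L M Q J : R) :
  gadget_params l r m q j lR rR L M Q J ->
  (r.+1 ^ m * r.+1 ^ (l * (r - q)) * 2 ^ r *
     (2 * (l * (r - q) * m) + m * m))%:R *
    expR (- ((q * (r - q))%:R * expR (- (9 / 10 * L)))) <= 1.
Proof.
move=> gp; have [lN rN rE cube L600 l1 l2 lL ME QE JE mM qQ jJ] := gp.
have [/andP[mM1 mM2] /andP[qQ1 qQ2] /andP[jJ1 jJ2]] := And3 mM qQ jJ.
have qs := params_q_small gp.
have rL := params_L_lt_r gp.
have rqE := params_rsubq gp.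
have l0 : 0 < lR by lra.
have r0 : 0 < rR by lra.
have L0 : 0 < L by lra.
have [r0' L0'] := (ltW r0, ltW L0).
have rL0 : 0 <= rR * L := mulr_ge0 r0' L0'.
have L1 : 1 <= L by lra.
have q0 := ler0n R q.
have rq0 : 0 <= rR - q%:R by clear - qs q0; lra.
have rq2 : rR / 2 <= rR - q%:R by clear - qs q0; lra.
have lL' : lR <= L by clear - l1 lL; lra.
have m0 := ler0n R m.
have [s sD] : exists s, s = (l * (r - q))%N by eexists.
rewrite -sD.
have sE : s%:R = lR * (rR - q%:R) by rewrite sD natrM rqE lN.
have s0 := ler0n R s.
have s_le : s%:R <= rR * L.
  rewrite sE mulrC; apply: ler_pM => //; [exact: le_trans l1|].
  by rewrite lerBlDr lerDl.
have m_le : m%:R <= rR * L.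
  apply: (le_trans mM2); rewrite -ME; apply: ler_peMr; first exact: le_trans m0 mM2.
  by clear - l1; lra.
have r1 : r.+1%:R <= expR (2 * L).
  have -> : 2 * L = L + L by ring.
  rewrite expRD -rE -natr1 -rN; apply: le_trans (_ : rR + rR <= _).
    by clear - rL L1; lra.
  by rewrite -mulr2n -mulr_natl ler_wpM2r //; clear - rL L1; lra.
have two : 2%:R <= expR 1 :> R by have := expR_ge1Dx (1 : R); clear; lra.
have LR : L <= rR by clear - rL; lra.
have r3 : 3 <= rR by clear - rL L600; lra.
have rest : (2 * (s * m) + m * m)%:R <= expR (5 * L).
  apply: (@le_trans _ _ (3 * (rR * L) ^+ 2)).
    rewrite natrD !natrM; move: m_le s_le; move: (rR * L) (m%:R) (s%:R) m0 s0.
    move=> z x y x0 y0 xz yz; have := ler_pM y0 x0 yz xz.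
    have := ler_pM x0 x0 xz xz; rewrite expr2; clear; lra.
  rewrite expRM_natl -rE.
  apply: (@le_trans _ _ (rR * (rR * rR) ^+ 2)); last first.
    by rewrite le_eqVlt; apply/orP; left; apply/eqP; ring.
  apply: ler_pM => //; first exact: exprn_ge0.
  by rewrite lerXn2r ?nnegrE ?mulr_ge0 ?ler_wpM2l.
have prod : (r.+1 ^ m * r.+1 ^ s * 2 ^ r * (2 * (s * m) + m * m))%:R <=
    expR (2 * L * m%:R + 2 * L * s%:R + rR + 5 * L).
  rewrite !expRD natrM [(_ * 2 ^ r)%:R]natrM [(r.+1 ^ m * _)%:R]natrM !natrX.
  have p n : r.+1%:R ^+ n <= expR (2 * L * n%:R).
    by rewrite mulrC expRM_natl lerXn2r ?nnegrE ?expR_ge0.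
  have p2 : 2%:R ^+ r <= expR rR.
    by rewrite rN -[X in expR X]mulr1 expRM_natl lerXn2r ?nnegrE ?expR_ge0.
  by do ?[apply: ler_pM => //; rewrite ?mulr_ge0 ?exprn_ge0].
apply: le_trans (ler_wpM2r (expR_ge0 _) prod) _.
rewrite -expRD -[leRHS]expR0 ler_expR subr_le0.
apply: (@le_trans _ _ (10 * (rR * L ^+ 2))).
  have h1 : 2 * L * m%:R <= 2 * (rR * L ^+ 2).
    have -> : 2 * (rR * L ^+ 2) = 2 * L * (rR * L) by ring.
    by rewrite ler_wpM2l ?mulr_ge0.
  have h2 : 2 * L * s%:R <= 2 * (rR * L ^+ 2).
    have -> : 2 * (rR * L ^+ 2) = 2 * L * (rR * L) by ring.
    by rewrite ler_wpM2l ?mulr_ge0.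
  have h3 : rR <= rR * L ^+ 2 by rewrite ler_peMr ?exprn_ege1.
  have h4 : 5 * L <= 5 * (rR * L ^+ 2) by clear - h3 LR; lra.
  clear - h1 h2 h3 h4; lra.
have eL : expR (- (9 / 10 * L)) * rR = expR (L / 10).
  by rewrite rE -expRD; congr expR; field.
rewrite -eL in cube.
rewrite natrM rqE; move: cube (expR_ge0 (- (9 / 10 * L))).
move: (expR _) => e cube e0.
have Qlow : rR / (18 * L) <= q%:R.
  apply: le_trans (ltW qQ1); rewrite ler_pdivrMr ?mulr_gt0 //.
  have l2L : 18 * lR ^+ 2 <= 18 * L ^+ 2.
    by rewrite ler_wpM2l // lerXn2r ?nnegrE // ltW.
  have Q0 := params_Q_ge0 gp.
  rewrite -(ler_pM2r L0) -QE.
  by have -> : Q * (18 * L) * L = Q * (18 * L ^+ 2); [ring|rewrite ler_wpM2l].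
apply: (@le_trans _ _ (rR / (18 * L) * (rR / 2) * e)); last first.
  by rewrite ler_wpM2r // ler_pM ?divr_ge0 ?mulr_ge0.
have -> : rR / (18 * L) * (rR / 2) * e = rR * (e * rR) / (36 * L) by field; rewrite gt_eqF.
rewrite ler_pdivlMr ?mulr_gt0 //.
have -> : 10 * (rR * L ^+ 2) * (36 * L) = rR * (360 * L ^+ 3) by ring.
by rewrite ler_wpM2l.
Qed.

Lemma gadget_gain (R : realType) l r m q j (lR rR L M Q J : R) :
  gadget_params l r m q j lR rR L M Q J ->  rR * L / (16 * lR) <= m%:R / 4 - lR * q%:R - 1.
Proof.
move=> gp; have [lN rN rE _ L600 l1 l2 lL ME QE JE mM qQ jJ] := gp.
have [/andP[mM1 mM2] /andP[qQ1 qQ2]] := conj mM qQ.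
have l0 : 0 < lR by lra.
have -> : rR * L / (16 * lR) = M / 8 by rewrite -ME; field; lra.
have lQ : lR * Q = M / 9.
  apply: (mulIf (_ : 18 * lR != 0)); first by rewrite mulf_neq0 // gt_eqF //; lra.
  have -> : lR * Q * (18 * lR) = Q * (18 * lR ^+ 2) by ring.
  by rewrite QE -ME; field.
(* The surplus [(1/4 - 1/9 - 1/8) M = M/72] has to cover [lR + 5/4]: the rounding of [q] and [m] and
   the final [- 1]. *)
have lq : lR * q%:R <= lR * (Q + 1) by rewrite ler_wpM2l //; lra.
have Mbig : 100 * L <= M.
  rewrite -(ler_pM2r (_ : 0 < 2 * lR)); last by lra.
  rewrite ME; apply: (@le_trans _ _ (2 * L * L)); last first.
    by rewrite ler_wpM2r ?(params_2L_le_r gp) //; lra.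
  have -> : 100 * L * (2 * lR) = 2 * L * (100 * lR) by ring.
  by rewrite ler_wpM2l //; lra.
move: lq; rewrite mulrDr lQ mulr1; lra.
Qed.

Lemma c_infty_random (R : realType) (l r : nat) (L x : R) :
  r%:R = expR L -> 360 * L ^+ 3 <= expR (L / 10) -> 600 <= L -> (0 < l)%N ->
  4 * L <= l%:R ^+ 2 -> 100 * l%:R <= L -> x <= L / (400 * l%:R) ->
  l%:R * r%:R + r%:R * L / (16 * l%:R) - l%:R * r%:R * expR (- x) <=
    c_infty R (copies l (complete_graph r)).
Proof.
move=> rE cube L600 l0 l2 lL xL.
have l0' : 0 < l%:R :> R by rewrite ltr0n.
have l1 : 1 <= l%:R :> R by rewrite ler1n.
have r0 : 0 <= r%:R :> R := ler0n R r.
have L0 : 0 < L by lra.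
pose M : R := r%:R * L / (2 * l%:R); pose Q : R := r%:R * L / (18 * l%:R ^+ 2).
pose J : R := L / (100 * l%:R).
have M0 : 0 <= M by rewrite divr_ge0 ?mulr_ge0 // ltW.
have Q0 : 0 <= Q by rewrite divr_ge0 ?mulr_ge0 ?exprn_ge0 // ltW.
have J1 : 1 <= J by rewrite ler_pdivlMr ?mulr_gt0 // mul1r.
have J0 : 0 <= J by lra.
pose m := Num.truncn M; pose q := (Num.truncn Q).+1; pose j := Num.truncn J.
have gp : gadget_params l r m q j l%:R r%:R L M Q J.
  split=> //.
  - by rewrite /M divfK // mulf_neq0 // gt_eqF.
  - by rewrite /Q divfK // mulf_neq0 // ?expf_neq0 // gt_eqF.
  - by rewrite /J divfK // mulf_neq0 // gt_eqF.
  - by have /andP[h1 h2] := truncn_itv M0; rewrite h1 ltrBlDr natr1 h2.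
  - have /andP[h1 h2] := truncn_itv Q0; rewrite h2 -natr1.
    by rewrite lerD2r h1.
  - have /andP[h1 h2] := truncn_itv J0.
    (* As [J >= 1], truncation loses at most half of it. *)
    have : 1 <= (Num.truncn J)%:R :> R.
      by rewrite ler1n -ltnS -(ltr_nat R) (le_lt_trans J1).
    by move: h1 h2; rewrite -natr1 -/j; lra.
have qr := params_q_le_r gp.
have gain := gadget_gain gp.
have m3 : (3 <= m)%N.
  rewrite -(ler_nat R); have := params_q_small gp; have rL := params_L_lt_r gp.
  have [_ _ _ _ _ _ _ _ ME _ _ /andP[mM1 mM2] _ _] := gp.
  have : 0 <= r%:R * L / (16 * l%:R) by rewrite divr_ge0 ?mulr_ge0 // ltW.
  have q1 : 1 <= q%:R :> R by rewrite ler1n.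
  have : 1 <= l%:R * q%:R :> R by rewrite -[leLHS]mulr1 ler_pM.
  move: gain; clear; lra.
have := c_infty_gadget l0 (ltn0Sn _) qr (leqnn _) m3 (connection_exponent gp) (union_bound gp).
apply: le_trans.
(* [2^-j <= e^(-j/2) <= e^(-J/4)], and [J/4 = L/(400 l)]. *)
have jx : (2 ^+ j)^-1 <= expR (- x).
  have -> : (2 ^+ j)^-1 = expR (- (j%:R * ln 2)) :> R.
    by rewrite expRN expRM_natl lnK // posrE.
  rewrite ler_expR lerN2; have [_ _ _ _ _ _ _ _ _ _ JE _ _ /andP[jJ _]] := gp.
  have xJ : x <= J / 4.
    by apply: le_trans xL _; rewrite /J le_eqVlt; apply/orP; left; apply/eqP; field; rewrite gt_eqF.
  have /andP[ln1 _] := ln2_bounds R.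
  have j0 := ler0n R j.
  apply: (@le_trans _ _ (j%:R * (1 / 2))); last by rewrite ler_wpM2l.
  by lra.
have rq0 : 0 <= r%:R - q%:R :> R by rewrite subr_ge0 ler_nat.
rewrite natrM natrB //.
have : l%:R * (r%:R - q%:R) * (2 ^+ j)^-1 <= l%:R * r%:R * expR (- x).
  by rewrite ler_pM ?mulr_ge0 ?invr_ge0 ?exprn_ge0 ?ler_wpM2l // lerBlDr lerDl.
set z := (2 ^+ j)^-1 => hz.
have -> : l%:R * (r%:R - q%:R) * (1 - z) =
  l%:R * r%:R - l%:R * q%:R - l%:R * (r%:R - q%:R) * z by ring.
move: hz gain; move: (l%:R * (r%:R - q%:R) * z) (l%:R * r%:R * expR (- x)).
move: (r%:R * L / (16 * l%:R)) => g y1 y2; clear; lra.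
Qed.

Theorem theorem5p2 (R : realType) :
  exists2 xi : R, 0 < xi &
    forall eps : R, 0 < eps <= 1 / 2 ->
      exists r0 : nat, forall r l : nat, (r0 <= r)%N ->
        Num.sqrt (ln (r%:R : R)) / eps <= (l%:R : R) <= ln (r%:R : R) ->
        c_infty R (copies l (complete_graph r)) >=
          l%:R * r%:R
          + (1 - eps) * (lambda R ^+ 2 * r%:R * ln (r%:R : R) / (4 * l%:R))
          - l%:R * r%:R * expR (- (xi * eps * ln (r%:R : R) / l%:R)).
Proof.
(* With [eps <= 1/2] the exponent is at most [L/(400 l)], as [c_infty_random] requires. *)
exists (1 / 200); first by lra.
move=> eps /andP[e0 e1]; pose C : R := Num.max 600 (360 * 50 ^+ 5).
exists (Num.truncn (expR C)).+1 => r l rC /andP[lo _].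
have rC' : expR C < r%:R.
  by apply: lt_le_trans (truncnS_gt _) _; rewrite ler_nat.
have rpos : 0 < r%:R :> R := lt_trans (expR_gt0 _) rC'.
set L := ln r%:R in lo *; have rE : r%:R = expR L by rewrite lnK.
have CL : C <= L by rewrite -ler_expR -rE ltW.
move: CL; rewrite ge_max => /andP[L600 /expR_beats_cube cube].
clear rC rC' C.
have L0 : 0 < L by lra.
have l0 : (0 < l)%N.
  by rewrite -(ltr_nat R); apply: lt_le_trans lo; rewrite divr_gt0 ?sqrtr_gt0.
have l0' : 0 < l%:R :> R by rewrite ltr0n.
have l2 : 4 * L <= l%:R ^+ 2.
  have h : 2 * Num.sqrt L <= l%:R.
    move: lo; rewrite ler_pdivrMr // => lo.
    by have := ler_wpM2l (ltW l0') e1; lra.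
  have -> : 4 * L = (2 * Num.sqrt L) ^+ 2.
    by rewrite exprMn sqr_sqrtr ?ltW // -natrX.
  by rewrite lerXn2r ?nnegrE ?mulr_ge0 ?sqrtr_ge0.
set g := r%:R * L / (16 * l%:R).
have g0 : 0 <= g by rewrite divr_ge0 ?mulr_ge0 // ltW.
have gain : (1 - eps) * (lambda R ^+ 2 * r%:R * L / (4 * l%:R)) <= g.
  have -> : lambda R ^+ 2 * r%:R * L / (4 * l%:R) = 4 * lambda R ^+ 2 * g.
    by rewrite /g; field; rewrite gt_eqF.
  have /andP[la0 la1] := lambda_bounds R.
  have la : 4 * lambda R ^+ 2 <= 1.
    have : lambda R ^+ 2 <= (1 / 2) ^+ 2 by rewrite lerXn2r ?nnegrE.
    by lra.
  have la' : 0 <= 4 * lambda R ^+ 2 by rewrite mulr_ge0 ?exprn_ge0.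
  rewrite mulrA ler_piMl //; apply: mulr_ile1 => //; lra.
set x := 1 / 200 * eps * L / l%:R.
have xl : x * l%:R = 1 / 200 * eps * L by rewrite /x divfK // gt_eqF.
apply: (@le_trans _ _ (l%:R * r%:R + g - l%:R * r%:R * expR (- x))).
  by rewrite lerD2r lerD2l.
have [lL|Ll] := lerP (100 * l%:R) L.
  apply: c_infty_random => //.
  have l400 : 0 < 400 * l%:R :> R by lra.
  rewrite (ler_pdivlMr _ _ l400) mulrCA xl.
  have := ler_wpM2l (ltW L0) e1; lra.
have r600 : 600 <= r%:R :> R.
  by rewrite rE; have := expR_ge1Dx L; lra.
have r2 : (2 <= r)%N by rewrite -(ler_nat R); lra.
apply: le_trans (c_infty_star R l0 r2).
(* For [L < 100 l] the subtracted term is at least [3/4] of [l r], while [g] is at most [l r / 64];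
   so [l r - 2 l] exceeds the claim. *)
have x4 : x <= 1 / 4.
  rewrite -(ler_pM2r l0') xl; have := ler_wpM2l (ltW L0) e1; lra.
have ex : l%:R * r%:R * (1 - x) <= l%:R * r%:R * expR (- x).
  by rewrite ler_wpM2l ?mulr_ge0 ?expR_ge1Dx // ltW.
have lr0 : 0 <= l%:R * r%:R :> R by rewrite mulr_ge0.
have ex' : l%:R * r%:R * (3 / 4) <= l%:R * r%:R * (1 - x).
  by rewrite ler_wpM2l //; lra.
have gl : g <= l%:R * r%:R / 64.
  rewrite /g ler_pdivrMr ?mulr_gt0 //.
  have -> : l%:R * r%:R / 64 * (16 * l%:R) = r%:R * (l%:R ^+ 2 / 4) :> R by field.
  by rewrite ler_wpM2l //; lra.
have : l%:R * 600 <= l%:R * r%:R :> R by rewrite ler_wpM2l // ltW.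
have -> : l%:R * (r%:R - 2) = l%:R * r%:R - 2 * l%:R :> R by ring.
move: (le_trans ex' ex) gl l0'; move: (l%:R * r%:R * expR (- x)) (l%:R * r%:R : R).
by clear; move=> ue u; lra.
Qed.
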